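(* If $A=\emptyset$, then $\lambda_A=\sqrt{e}$. Moreover, $\mu_A$ is given by $$d\mu_A=\frac{1}{2\pi}\sqrt{\frac{4\sqrt{e}-x}{e\,x}}\;dx$$ on the interval $[0,4\sqrt e]$.
   Context: $\mathbb{R}^+=[0,\infty)$, and $I(\mu)=\iint\log|x_1-x_2|\,d\mu(x_1)\,d\mu(x_2)$ is the logarithmic energy. For a finite set $A\subset\mathbb{Z}[x]$ of nonzero polynomials with only real roots, $\lambda_A=\inf_\mu\int x\,d\mu(x)$, where $\mu$ ranges over the Borel probability measures supported on $\mathbb{R}^+$ with $I(\mu)\ge 0$ and $\int\log|Q(x)|\,d\mu(x)\ge0$ for every $Q\in A$ (for $A=\emptyset$ the only constraint is $I(\mu)\ge 0$). $\mu_A$ denotes the unique such measure attaining the infimum. *)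

(* Defs.v *)
From HB Require Import structures.
From mathcomp Require Import all_boot all_order all_algebra.
From mathcomp Require Import complex finmap.
From mathcomp Require Import all_classical all_reals all_analysis.

Set Implicit Arguments.
Unset Strict Implicit.
Unset Printing Implicit Defensive.

Import Order.TTheory GRing.Theory Num.Theory.
Import numFieldNormedType.Exports.

Local Open Scope classical_set_scope.
Local Open Scope ring_scope.

Notation borel_prob R := (probability (measurableTypeR R) R).

Definition nonzero_real_rooted (R : realType) (Q : {poly int}) : Prop :=
  Q != 0 /\
  forall z : complex R, root (map_poly intr Q) z -> complex.Im z = 0.

(* Since [lne 0 = -oo], atoms force the energy to be [-oo].  If the positive
   and negative parts of the integrand both have infinite integral, the
   library integral is [-oo], so such a measure fails [0 <= log_energy mu];
   this cannot happen when [mu] is supported on [0, +oo[ with finite mean,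
   because the positive part of log|x - y| is then integrable. *)
Definition log_energy (R : realType) (mu : borel_prob R) : \bar R :=
  (\int[mu \x mu]_z lne (`|z.1 - z.2|%:E))%E.

Definition log_mean (R : realType) (mu : borel_prob R) (Q : {poly int}) :
    \bar R :=
  (\int[mu]_x lne (`|(map_poly intr Q).[x]|%:E))%E.

Definition mean (R : realType) (mu : borel_prob R) : \bar R :=
  (\int[mu]_x x%:E)%E.

Definition feasible (R : realType) (A : {fset {poly int}})
    (mu : borel_prob R) : Prop :=
  [/\ mu [set x : R | x < 0] = 0%E,
      (0 <= log_energy mu)%E
    & forall Q, Q \in A -> (0 <= log_mean mu Q)%E].

Definition lambda (R : realType) (A : {fset {poly int}}) : \bar R :=
  ereal_inf [set mean mu | mu in feasible (R := R) A].

Definition minimizer (R : realType) (A : {fset {poly int}})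
    (mu : borel_prob R) : Prop :=
  feasible A mu /\ mean mu = lambda R A.

Definition unique_minimizer (R : realType) (A : {fset {poly int}})
    (mu : borel_prob R) : Prop :=
  minimizer A mu /\
  forall nu : borel_prob R, minimizer A nu ->
    forall B : set (measurableTypeR R), measurable B -> nu B = mu B.

Definition sqrt_e (R : realType) : R := Num.sqrt (expR 1).

(* The value at [x = 0], where the formula divides by zero, is irrelevant. *)
Definition density_empty (R : realType) (x : R) : R :=
  (2 * pi)^-1 * Num.sqrt ((4 * sqrt_e R - x) / (expR 1 * x)).

(* Main.v *)
Require Import Defs.
From HB Require Import structures.
From mathcomp Require Import all_boot all_order all_algebra.
From mathcomp Require Import complex finmap.
From mathcomp Require Import all_classical all_reals all_analysis.
From mathcomp Require Import measurable_realfun ring lra.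

(* Write [s] for the square root of [e].

   For [L > 0] let [k_L d] be the integral of [max 0 (r - d) / r ^ 2] over
   [0 < r <= L]; for [0 < d <= L] it equals [ln L - ln d - 1 + d / L].  Since
   [max 0 (r - |x - y|)] is the length of the set of [z] such that the window
   [z, z + r] contains both [x] and [y], the mutual energy of two probability
   measures for the kernel [k_L] is an inner product of the functions
   [(r, z) |-> m [z, z + r] / r], and
     [E_L(m, m) - 2 E_L(m, n) + E_L(n, n)]
   is the integral of the square of the difference of two such functions (the
   discrepancy of [m] and [n]).  Letting [L] tend to infinity gives the negative
   semi-definiteness of the logarithmic energy on differences of probability
   measures, together with the equality case, as the masses of the windows
   determine the measure.

   Let [n] be the law of the statement.  It is the image of
   [(1 - cos phi) / pi dphi] on [0, pi] by [phi |-> s * (2 + 2 * cos phi)], and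
   its potential [U] satisfies [U x = x / (2 * s) - 1 / 2] on [0, 4 * s] and
   [U x <= x / (2 * s) - 1 / 2] beyond.  As [n] has mean [s], its energy is [0].
   If [m] has finite mean [a] and nonnegative energy, then
     [0 <= discrepancy <= - I(m) + 2 * \int U dm - I(n) <= a / s - 1]
   up to [O(1 / L)], so that [s <= a], and [a = s] forces [m = n].

   The potential is computed by regularization: the expansion of
   [ln (1 - 2 * rho * cos u + rho ^ 2)] in powers of [rho] gives it at the points
   [s * (2 + w + 1 / w)] with [w = rho * exp (i * theta)], and [rho] tends to [1]. *)

Set Implicit Arguments.
Unset Strict Implicit.
Unset Printing Implicit Defensive.

Import Order.TTheory GRing.Theory Num.Theory.
Import numFieldNormedType.Exports.

Local Open Scope classical_set_scope.
Local Open Scope ring_scope.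

(** * Logarithmic potential of the law (1 - cos phi) / pi dphi in the angle *)

Section real_derivatives.
Context {R : realType}.
Implicit Types f g : R -> R.

Lemma is_derive_addf f g (x df dg : R) :
  is_derive x 1 f df -> is_derive x 1 g dg ->
  is_derive x 1 (fun y => f y + g y) (df + dg).
Proof. exact: is_deriveD. Qed.

Lemma is_derive_mull (c : R) f (x df : R) :
  is_derive x 1 f df -> is_derive x 1 (fun y => c * f y) (c * df).
Proof. exact: is_deriveZ. Qed.

Lemma is_derive_expf n (x : R) :
  is_derive x 1 (fun y : R => y ^+ n) (n%:R * x ^+ n.-1).
Proof.
have : is_derive x 1 ((@id R) ^+ n) ((n%:R * x ^+ n.-1) *: (1 : R)) by exact: is_deriveX.
rewrite [_ *: _]mulr1; congr is_derive.
by apply/funext => y; rewrite exprfctE.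
Qed.

Lemma is_derive_lnf f (x df : R) : 0 < f x ->
  is_derive x 1 f df -> is_derive x 1 (fun y => ln (f y)) (df / f x).
Proof.
move=> fx dfx; have dln := is_derive1_ln fx.
rewrite mulrC; exact: (@is_derive1_comp _ _ f _ _ _ dln dfx).
Qed.

Lemma is_derive_inv (x : R) : 0 < x -> is_derive x 1 (fun y : R => y^-1) (- x ^- 2).
Proof.
move=> x0; have := @is_deriveV R id x 1 1.
by rewrite [- _ *: _]mulr1; apply; rewrite gt_eqF.
Qed.

Lemma is_derive_continuous f (x df : R) :
  is_derive x 1 f df -> {for x, continuous f}.
Proof.
by move=> dfx; apply/differentiable_continuous/derivable1_diffP; exact: ex_derive.
Qed.

End real_derivatives.

(** * Truncated cosine series of the logarithm *)

Section log_cosine_series.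
Context {R : realType}.
Implicit Types rho u x : R.

(** The squared modulus of [1 - x * exp (i * u)]. *)
Let q x u := 1 - 2 * x * cos u + x ^+ 2.

Lemma cosine_quadratic_ge x u : 0 <= x -> (1 - x) ^+ 2 <= q x u.
Proof. by move=> x0; rewrite /q; have := cos_le1 u; nra. Qed.

Lemma cosine_quadratic_gt0 x u : 0 <= x < 1 -> 0 < q x u.
Proof.
move=> /andP[x0 x1]; apply: lt_le_trans (cosine_quadratic_ge u x0).
by rewrite exprn_gt0// subr_gt0.
Qed.

(** The recurrence [cos ((N + 2) u) = 2 cos u cos ((N + 1) u) - cos (N u)] makes the product with
    [q x u] collapse to boundary terms. The sum is the derivative in [x] of the truncated
    logarithmic series. *)
Lemma cosine_sum_telescope x u N :
  q x u * \sum_(n < N) x ^+ n * cos (n.+1%:R * u) =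
  cos u - x - x ^+ N * cos (N.+1%:R * u) + x ^+ N.+1 * cos (N%:R * u).
Proof.
elim: N => [|N ih].
  by rewrite big_ord0 mulr0 !mul1r mul0r cos0 expr1; ring.
rewrite big_ord_recr/= mulrDr ih.
have -> : cos (N.+2%:R * u) = 2 * cos u * cos (N.+1%:R * u) - cos (N%:R * u).
  have e2 : N.+2%:R * u = N.+1%:R * u + u by rewrite -[N.+2%:R]natr1; ring.
  have e0 : N%:R * u = N.+1%:R * u - u by rewrite -[N.+1%:R]natr1; ring.
  by rewrite e2 e0 cosD cosB; ring.
by rewrite /q !exprS; ring.
Qed.

Lemma is_derive_cosine_sum x u N : is_derive x 1
  (fun y => \sum_(n < N) y ^+ n.+1 / n.+1%:R * cos (n.+1%:R * u))
  (\sum_(n < N) x ^+ n * cos (n.+1%:R * u)).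
Proof.
elim: N => [|N ih].
  rewrite big_ord0.
  under [X in is_derive _ _ X]eq_fun do rewrite big_ord0.
  exact: is_derive_cst.
rewrite big_ord_recr/=.
under [X in is_derive _ _ X]eq_fun do rewrite big_ord_recr/=.
apply: is_derive_addf => //.
set c := cos _.
have := is_derive_mull (c / N.+1%:R) (is_derive_expf N.+1 x).
have N0 : N.+1%:R != 0 :> R by rewrite pnatr_eq0.
have -> : c / N.+1%:R * (N.+1%:R * x ^+ N.+1.-1) = x ^+ N * c.
  by rewrite mulrA divfK// mulrC.
by congr is_derive; apply/funext => y; rewrite [RHS]mulrC mulrA mulrAC.
Qed.

(** The function inside the absolute value vanishes at radius [0], and its derivative retains only
    terms with a factor [x ^ N], divided by [q], which is at least [(1 - rho) ^ 2] up to radius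
    [rho]. The mean value theorem concludes. *)
Lemma log_cosine_series_bound rho u N : 0 <= rho < 1 ->
  `|ln (q rho u) +
    2 * \sum_(n < N) rho ^+ n.+1 / n.+1%:R * cos (n.+1%:R * u)|
  <= 4 * rho ^+ N / (1 - rho) ^+ 2.
Proof.
move=> /andP[]; rewrite le_eqVlt => /predU1P[<- _|rho0 rho1].
  rewrite /q mulr0 mul0r subr0 expr0n/= addr0 ln1 add0r big1 ?mulr0 ?normr0.
    by rewrite expr1n divr1 mulr_ge0// exprn_ge0.
  by move=> n _; rewrite expr0n/= !mul0r.
pose S x := \sum_(n < N) x ^+ n.+1 / n.+1%:R * cos (n.+1%:R * u).
pose f x := ln (q x u) + 2 * S x.
pose df x := 2 * (x ^+ N.+1 * cos (N%:R * u) - x ^+ N * cos (N.+1%:R * u)) / q x u.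
have dq x : is_derive x 1 (q ^~ u) (- 2 * cos u + 2%:R * x ^+ 1).
  have -> : q ^~ u = (fun y => (1 + - 2 * cos u * y) + y ^+ 2).
    by apply/funext => y; rewrite /q; ring.
  apply: is_derive_addf; last exact: is_derive_expf.
  by apply: is_derive_eq; rewrite add0r mul1r [LHS]mulr1.
have dfx x : 0 <= x < 1 -> is_derive x 1 f (df x).
  move=> x01.
  have q0 := cosine_quadratic_gt0 u x01.
  apply: is_derive_eq.
    apply: is_derive_addf; first exact: is_derive_lnf (dq x).
    by apply: is_derive_mull; exact: is_derive_cosine_sum.
  (* The part [cos u - x] of the telescoped sum cancels the derivative of [ln (q x u)]. *)
  have := cosine_sum_telescope x u N.
  set T := \sum_(n < N) _.
  have q1 := lt0r_neq0 q0.
  move=> hT; have -> : T = (q x u * T) / q x u by rewrite mulrC mulKf.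
  by rewrite hT /df; field.
have [x xI||c] := @MVT R f df 0 rho rho0.
- by apply: dfx; move: xI; rewrite in_itv/= => /andP[/ltW -> /lt_trans->].
- have: {in `[0, rho], continuous f}.
    move=> x; rewrite in_itv/= => /andP[x0 xrho].
    apply: is_derive_continuous; apply: dfx.
    by rewrite x0 (le_lt_trans xrho).
  by move=> cf; apply: continuous_in_subspaceT => x /set_mem; exact: cf.
rewrite in_itv/= subr0 => /andP[c0 crho].
have -> : f 0 = 0.
  rewrite /f /S /q mulr0 mul0r subr0 expr0n/= addr0 ln1 add0r big1 ?mulr0//.
  by move=> n _; rewrite expr0n/= !mul0r.
rewrite subr0 -/(S rho) -/(f rho) => ->.
have r1 : 0 < 1 - rho by rewrite subr_gt0.
rewrite normrM (gtr0_norm rho0) /df normrM normfV.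
have q0 : (1 - rho) ^+ 2 <= q c u.
  apply: le_trans (cosine_quadratic_ge u (ltW c0)).
  by rewrite lerXn2r// ?nnegrE; lra.
have r2 : 0 < (1 - rho) ^+ 2 by rewrite exprn_gt0.
rewrite (gtr0_norm (lt_le_trans r2 q0)).
have cN : c ^+ N <= rho ^+ N by rewrite lerXn2r// ?nnegrE ltW.
have cN0 : 0 <= c ^+ N by rewrite exprn_ge0// ltW.
have num : `|2 * (c ^+ N.+1 * cos (N%:R * u) - c ^+ N * cos (N.+1%:R * u))| <=
    4 * rho ^+ N.
  have -> : 4 * rho ^+ N = 2 * (2 * rho ^+ N) by ring.
  rewrite normrM ger0_norm// ler_pM2l//.
  rewrite (le_trans (ler_normB _ _))// !normrM !(ger0_norm (exprn_ge0 _ (ltW c0))).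
  have c1 : c <= 1 by rewrite ltW// (lt_trans crho).
  have h1 := ler_piMr cN0 (cos_max (N.+1%:R * u)).
  have h2 := ler_piMr (mulr_ge0 (ltW c0) cN0) (cos_max (N%:R * u)).
  have h3 := ler_piMl cN0 c1.
  rewrite mulr2n mulrDl mul1r lerD// ?(le_trans h1)//.
  by rewrite exprS (le_trans h2)// (le_trans h3).
have qV0 : 0 <= (q c u)^-1 by rewrite invr_ge0 (le_trans (ltW r2)).
apply: le_trans (ler_piMr _ (ltW rho1)) _; first by rewrite mulr_ge0.
by rewrite ler_pM// lef_pV2// posrE (lt_le_trans r2).
Qed.
End log_cosine_series.

(** * Integrals of cosines against the weight [1 - cos] *)

Section cosine_integrals.
Context {R : realType}.
Local Notation mu := (@lebesgue_measure R).
Implicit Types (f F : R -> R) (a b rho theta : R).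

Lemma integral_is_derive_itv (f F : R -> R) (a b : R) : a < b ->
  {in `[a, b], continuous f} ->
  (forall x : R, a <= x <= b -> is_derive x 1 F (f x)) ->
  (\int[mu]_(x in `[a, b]) (f x)%:E = (F b - F a)%:E)%E.
Proof.
move=> ab cf dF; rewrite EFinB; apply: continuous_FTC2 => //.
- by apply: continuous_in_subspaceT => x /set_mem; exact: cf.
- split => [x||].
  + by rewrite in_itv/= => /andP[ax xb]; apply: ex_derive; apply: dF; rewrite !ltW.
  + apply: cvg_at_right_filter; apply: is_derive_continuous.
    by apply: dF; rewrite lexx ltW.
  + apply: cvg_at_left_filter; apply: is_derive_continuous.
    by apply: dF; rewrite lexx ltW.
- move=> x; rewrite in_itv/= => /andP[ax xb]; rewrite derive1E.
  by apply: derive_val; apply: dF; rewrite !ltW.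
Qed.

Lemma integral_is_derive f F a b : a < b -> continuous f ->
  (forall x : R, is_derive x 1 F (f x)) ->
  (\int[mu]_(x in `[a, b]) (f x)%:E = (F b - F a)%:E)%E.
Proof. by move=> ab cf dF; apply: integral_is_derive_itv => // x _. Qed.

Lemma continuous_integrable_itv f a b : continuous f ->
  mu.-integrable `[a, b] (EFin \o f).
Proof.
move=> cf; apply: continuous_compact_integrable; first exact: segment_compact.
exact: continuous_subspaceT.
Qed.

Lemma sin_nat_pi n : sin (n%:R * pi) = 0 :> R.
Proof.
elim: n => [|n ih]; first by rewrite mul0r sin0.
by rewrite -natr1 mulrDl mul1r sinDpi ih oppr0.
Qed.

Lemma is_derive_sin_nat n (x : R) :
  is_derive x 1 (fun y => sin (n%:R * y)) (n%:R * cos (n%:R * x)).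
Proof.
have dn : is_derive x 1 (fun y => n%:R * y) (n%:R * 1).
  by apply: is_derive_mull; exact: is_derive_id.
have -> : n%:R * cos (n%:R * x) = cos (n%:R * x) * (n%:R * 1) by rewrite mulr1 mulrC.
exact: (@is_derive1_comp _ sin (fun y => n%:R * y) x _ _ _ dn).
Qed.

Lemma continuous_cos_nat n : continuous (fun x : R => cos (n%:R * x)).
Proof.
move=> x; apply: continuous_comp; last exact: continuous_cos.
by apply: continuousM; [exact: cvg_cst|exact: cvg_id].
Qed.

Lemma continuous_one_sub_cos : continuous (fun x : R => 1 - cos x).
Proof. by move=> x; apply: continuousB; [exact: cvg_cst|exact: continuous_cos]. Qed.

(** The product is a combination of cosines of frequencies [n], [n + 1] and [n + 2], whose
    primitives vanish at [0] and [pi]; a constant term survives only for [n = 0]. Hence the weight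
    selects the first Fourier coefficient. *)
Lemma integral_cos_one_sub_cos n :
  \int[mu]_(x in `[0, pi]) (cos (n.+1%:R * x) * (1 - cos x)) =
  if n == 0 then - (pi / 2) else 0.
Proof.
rewrite /Rintegral.
have cf : continuous (fun x : R => cos (n.+1%:R * x) * (1 - cos x)).
  by move=> x; apply: cvgM; [exact: continuous_cos_nat|exact: continuous_one_sub_cos].
have [n0|n0] := eqVneq n 0.
  pose F (x : R) := 1%:R * sin (1%:R * x) + (- (2^-1) * x + - 4^-1 * sin (2%:R * x)).
  have dF (x : R) : is_derive x 1 F (cos (n.+1%:R * x) * (1 - cos x)).
    have -> : cos (n.+1%:R * x) * (1 - cos x) = 1%:R * (1%:R * cos (1%:R * x)) +
        (- 2^-1 * 1 + - 4^-1 * (2%:R * cos (2%:R * x))).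
      have -> : cos (2 * x) = cos x ^+ 2 *+ 2 - 1 by rewrite mulr_natl cos_mulr2n.
      rewrite n0 !mul1r; set c := cos x.
      by rewrite !mulr2n; field.
    apply: is_derive_addf; first by apply: is_derive_mull; exact: is_derive_sin_nat.
    apply: is_derive_addf; apply: is_derive_mull; exact: is_derive_sin_nat.
  rewrite (integral_is_derive _ cf dF) ?pi_gt0//= /F !sin_nat_pi !mulr0 sin0 !mulr0.
  lra.
have [m em] : exists m, n = m.+1 by case: n n0 {cf} => // m _; exists m.
pose F (x : R) := m.+2%:R^-1 * sin (m.+2%:R * x) +
  (- (2^-1 / m.+3%:R) * sin (m.+3%:R * x) + - (2^-1 / m.+1%:R) * sin (m.+1%:R * x)).
have nz k : k.+1%:R != 0 :> R by rewrite pnatr_eq0.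
have dF (x : R) : is_derive x 1 F (cos (n.+1%:R * x) * (1 - cos x)).
  have -> : cos (n.+1%:R * x) * (1 - cos x) =
     m.+2%:R^-1 * (m.+2%:R * cos (m.+2%:R * x)) +
     (- (2^-1 / m.+3%:R) * (m.+3%:R * cos (m.+3%:R * x)) +
      - (2^-1 / m.+1%:R) * (m.+1%:R * cos (m.+1%:R * x))).
    have e1 : m.+3%:R * x = m.+2%:R * x + x by rewrite -[m.+3%:R]natr1; ring.
    have e2 : m.+1%:R * x = m.+2%:R * x - x by rewrite -[m.+2%:R]natr1; ring.
    by rewrite em mulKf// !mulNr -!(mulrA 2^-1) !mulKf// e1 e2 cosD cosB; field.
  by do 2 ?[apply: is_derive_addf]; apply: is_derive_mull; exact: is_derive_sin_nat.
by rewrite (integral_is_derive _ cf dF) ?pi_gt0//= /F !sin_nat_pi !mulr0 sin0 !mulr0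
  !addr0 subrr.
Qed.

End cosine_integrals.

(** * Potential at [w + 1 / w] with [w = rho exp (i theta)], off the segment *)

Section joukowski_potential.
Context {R : realType}.
Local Notation mu := (@lebesgue_measure R).
Implicit Types rho theta phi : R.

Let q (x u : R) := 1 - 2 * x * cos u + x ^+ 2.

Let continuous_ln_q rho theta (e : R) : 0 <= rho < 1 ->
  continuous (fun phi => ln (q rho (theta + e * phi))).
Proof.
move=> rho01 phi; apply: continuous_comp; last first.
  by apply: continuous_ln; exact: cosine_quadratic_gt0.
apply: cvgD; last exact: cvg_cst.
apply: cvgB; first exact: cvg_cst.
apply: cvgM; first exact: cvg_cst.
apply: continuous_comp; last exact: continuous_cos.
apply: cvgD; first exact: cvg_cst.
by apply: cvgM; [exact: cvg_cst|exact: cvg_id].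
Qed.

(** Truncation of the series of [joukowski] below: adding the series at [theta + phi] and
    [theta - phi] leaves products of a cosine in [theta] and a cosine in [phi]. *)
Let trig_sum rho theta N phi : R :=
  \sum_(n < N) (- 4 * (rho ^+ n.+1 / n.+1%:R) * cos (n.+1%:R * theta)) *
    (cos (n.+1%:R * phi) * (1 - cos phi)).

Let continuous_trig_sum rho theta N : continuous (trig_sum rho theta N).
Proof.
elim: N => [|N ih].
  have -> : trig_sum rho theta 0 = cst 0 by apply/funext => x; rewrite /trig_sum big_ord0.
  by move=> x; exact: cvg_cst.
have -> : trig_sum rho theta N.+1 = fun phi => trig_sum rho theta N phi +
    (- 4 * (rho ^+ N.+1 / N.+1%:R) * cos (N.+1%:R * theta)) *
    (cos (N.+1%:R * phi) * (1 - cos phi)).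
  by apply/funext => x; rewrite /trig_sum big_ord_recr.
move=> x; apply: cvgD; first exact: ih.
apply: cvgM; first exact: cvg_cst.
by apply: cvgM; [exact: continuous_cos_nat|exact: continuous_one_sub_cos].
Qed.

(** Only the first term contributes; [N.+1] ensures that it is present. *)
Let integral_trig_sum rho theta N :
  \int[mu]_(x in `[0, pi]) trig_sum rho theta N.+1 x = 2 * pi * rho * cos theta.
Proof.
have cg n : continuous (fun phi : R => cos (n.+1%:R * phi) * (1 - cos phi)).
  by move=> x; apply: cvgM; [exact: continuous_cos_nat|exact: continuous_one_sub_cos].
elim: N => [|N ih].
  rewrite /trig_sum; under eq_Rintegral do rewrite big_ord1.
  rewrite RintegralZl//; last exact: continuous_integrable_itv (cg 0%N).
  by rewrite integral_cos_one_sub_cos/= mul1r; field.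
have -> : trig_sum rho theta N.+2 = fun phi => trig_sum rho theta N.+1 phi +
    (- 4 * (rho ^+ N.+2 / N.+2%:R) * cos (N.+2%:R * theta)) *
    (cos (N.+2%:R * phi) * (1 - cos phi)).
  by apply/funext => x; rewrite /trig_sum big_ord_recr.
rewrite RintegralD//.
- rewrite ih RintegralZl//; last exact: continuous_integrable_itv (cg N.+1).
  by rewrite integral_cos_one_sub_cos/= mulr0 addr0.
- exact: continuous_integrable_itv.
- apply: continuous_integrable_itv => x; apply: cvgM; first exact: cvg_cst.
  exact: cg.
Qed.

(** Logarithm of [|w - exp (i phi)| ^ 2 |w - exp (- i phi)| ^ 2], weighted. The signs are factors
    [1] and [-1] to match [continuous_ln_q]. *)
Let joukowski rho theta phi :=
  (ln (q rho (theta + 1 * phi)) + ln (q rho (theta + -1 * phi))) * (1 - cos phi).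

Let joukowski_trig_sum rho theta phi N : 0 <= rho < 1 ->
  `|joukowski rho theta phi - trig_sum rho theta N phi| <=
    16 / (1 - rho) ^+ 2 * rho ^+ N.
Proof.
move=> rho01; rewrite /joukowski /trig_sum.
set b := 4 * rho ^+ N / (1 - rho) ^+ 2.
have h1 := log_cosine_series_bound (theta + 1 * phi) N rho01.
have h2 := log_cosine_series_bound (theta + -1 * phi) N rho01.
rewrite -/(q rho _) -/b in h1; rewrite -/(q rho _) -/b in h2.
set S1 := \sum_(n < N) _ in h1; set S2 := \sum_(n < N) _ in h2.
have -> : \sum_(n < N) - 4 * (rho ^+ n.+1 / n.+1%:R) * cos (n.+1%:R * theta) *
    (cos (n.+1%:R * phi) * (1 - cos phi)) = - (2 * S1 + 2 * S2) * (1 - cos phi).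
  rewrite /S1 /S2 -mulrDr -big_split/= mulr_sumr -sumrN mulr_suml.
  apply: eq_bigr => n _; rewrite mul1r mulN1r (mulrDr _ theta phi) (mulrBr _ theta phi) cosD cosB.
  by ring.
rewrite -mulrBl opprK normrM.
have c2 : `|1 - cos phi| <= 2.
  by rewrite ger0_norm; have := cos_geN1 phi; have := cos_le1 phi; lra.
rewrite addrACA.
have -> : 16 / (1 - rho) ^+ 2 * rho ^+ N = (b + b) * 2 by rewrite /b; ring.
by rewrite ler_pM// (le_trans (ler_normD _ _))// lerD.
Qed.

(** The argument of the logarithm is [|w + 1 / w - 2 cos phi| ^ 2], a product of two factors [q]
    divided by [rho ^ 2]. The factors [q] contribute through their first Fourier coefficient alone;
    the division contributes [- 2 pi ln rho], the weight having integral [pi]. *)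
Lemma integral_joukowski rho theta : 0 < rho < 1 ->
  (\int[mu]_(phi in `[0%R, pi])
     (ln ((rho + rho^-1 - 2 * cos (theta + phi)) *
          (rho + rho^-1 - 2 * cos (theta - phi))) * (1 - cos phi))%:E =
   (2 * pi * (rho * cos theta - ln rho))%:E)%E.
Proof.
move=> /andP[rho0 rho1]; have rho01 : 0 <= rho < 1 by rewrite ltW.
have cj : continuous (joukowski rho theta).
  move=> x; apply: cvgM; last exact: continuous_one_sub_cos.
  by apply: cvgD; exact: continuous_ln_q.
have cw := @continuous_one_sub_cos R.
have ij := continuous_integrable_itv 0 pi cj.
have -> : (\int[mu]_(phi in `[0%R, pi])
     (ln ((rho + rho^-1 - 2 * cos (theta + phi)) *
          (rho + rho^-1 - 2 * cos (theta - phi))) * (1 - cos phi))%:E =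
   \int[mu]_(phi in `[0%R, pi]) (joukowski rho theta phi +
      (- 2 * ln rho) * (1 - cos phi))%:E)%E.
  apply: eq_integral => phi _; congr EFin.
  have q0 u : 0 < q rho u by exact: cosine_quadratic_gt0.
  have qE u : rho + rho^-1 - 2 * cos u = q rho u / rho.
    by rewrite /q; field; rewrite gt_eqF.
  rewrite !qE /joukowski mul1r mulN1r lnM ?posrE ?divr_gt0// !ln_div ?posrE//.
  by ring.
(* All nonempty truncations have this integral, and they approximate [joukowski] uniformly in [phi]
   with an error of order [rho ^ N]. *)
have ej : \int[mu]_(x in `[0, pi]) joukowski rho theta x = 2 * pi * rho * cos theta.
  set J := LHS.
  pose K := 16 / (1 - rho) ^+ 2 * pi.
  have JK N : `|J - 2 * pi * rho * cos theta| <= K * rho ^+ N.+1.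
    rewrite -(integral_trig_sum rho theta N) -RintegralB//; last first.
      exact: continuous_integrable_itv.
    have cjt : continuous (fun x => joukowski rho theta x - trig_sum rho theta N.+1 x).
      by move=> x; apply: cvgB; [exact: cj|exact: continuous_trig_sum].
    apply: le_trans (le_normr_Rintegral _ _) _ => //.
      exact: continuous_integrable_itv.
    apply: (@le_trans _ _ (\int[mu]_(x in `[0, pi]) (16 / (1 - rho) ^+ 2 * rho ^+ N.+1))).
      apply: le_Rintegral => //.
      - by apply: integrable_norm; exact: continuous_integrable_itv.
      - by apply: continuous_integrable_itv => x; exact: cvg_cst.
      - by move=> x _; exact: joukowski_trig_sum.
    rewrite /Rintegral integral_cst//= lebesgue_measure_itv/= lte_fin pi_gt0/=.
    by rewrite subr0 /K mulrAC.
  have cK : geometric K rho @ \oo --> 0 by apply: cvg_geometric; rewrite gtr0_norm.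
  have : `|J - 2 * pi * rho * cos theta| <= 0.
    apply: cvgr_to_ge cK _; exists 1%N => // -[//|N] _; exact: JK.
  by rewrite normr_le0 subr_eq0 => /eqP.
have iw : (\int[mu]_(x in `[0%R, pi]) (1 - cos x)%:E = pi%:E)%E.
  have dF (x : R) : is_derive x 1 (fun y => y + -1 * sin y) (1 - cos x).
    have -> : 1 - cos x = 1 + -1 * cos x by rewrite mulN1r.
    by apply: is_derive_addf; apply: is_derive_mull.
  by rewrite (integral_is_derive (pi_gt0 R) cw dF) sinpi sin0; congr EFin; ring.
have cwc : continuous (fun x : R => - 2 * ln rho * (1 - cos x)).
  by move=> x; apply: cvgM; [exact: cvg_cst|exact: cw].
have -> : (\int[mu]_(x in `[0%R, pi]) (joukowski rho theta x + - 2 * ln rho * (1 - cos x))%:E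
  = \int[mu]_(x in `[0%R, pi]) (joukowski rho theta x)%:E +
    (- 2 * ln rho)%:E * \int[mu]_(x in `[0%R, pi]) (1 - cos x)%:E)%E.
  rewrite -integralZl//; last exact: continuous_integrable_itv.
  rewrite -integralD//; first exact: (continuous_integrable_itv _ _ cwc).
rewrite iw -EFinM -[X in (X + _)%E]fineK.
  rewrite -[fine _]/(\int[mu]_(x in `[0, pi]) joukowski rho theta x) ej -EFinD.
  by congr EFin; ring.
exact: integrable_fin_num.
Qed.

End joukowski_potential.

(** * The limit [rho -> 1]: potential on the segment *)

Section arc_potential.
Context {R : realType}.
Local Notation mu := (@lebesgue_measure R).
Implicit Types theta phi t : R.

Let P theta t phi : R := (t - 2 * cos (theta + phi)) * (t - 2 * cos (theta - phi)).

(** At [t = 2] only the squared chord remains, which identifies the limit of [P] as [t] decreases to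
    [2]. *)
Let PE theta t phi : P theta t phi =
  `|2 * cos theta - 2 * cos phi| ^+ 2 + (t - 2) * (t + 2 - 4 * (cos theta * cos phi)).
Proof.
rewrite real_normK ?num_real// /P cosD cosB.
have := sin2cos2 theta; have := sin2cos2 phi.
set c := cos theta; set d := cos phi; set s := sin theta; set e := sin phi => h1 h2.
have -> : (t - 2 * (c * d - s * e)) * (t - 2 * (c * d + s * e)) =
  t ^+ 2 - 4 * t * (c * d) + 4 * (c ^+ 2 * d ^+ 2) - 4 * (s ^+ 2 * e ^+ 2) by ring.
by rewrite h1 h2; ring.
Qed.

Let cos_prod_le1 theta phi : cos theta * cos phi <= 1.
Proof.
have := cos_max theta; have := cos_max phi; rewrite !ler_norml.
move=> /andP[a b] /andP[c d]; nra.
Qed.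

Let P_gt0 theta t phi : 2 < t -> 0 < P theta t phi.
Proof.
move=> t2; have h u : 0 < t - 2 * cos u by have := cos_le1 u; lra.
by rewrite mulr_gt0.
Qed.

Let P_homo theta t t' phi : 2 <= t -> t <= t' -> P theta t phi <= P theta t' phi.
Proof.
move=> t2 tt'.
have a u : 0 <= t - 2 * cos u by have := cos_le1 u; lra.
by rewrite ler_pM// lerB.
Qed.

Let P_le theta t phi : 2 <= t <= 4 -> P theta t phi <= 6 ^+ 2.
Proof.
move=> /andP[t2 t4].
have a u : 0 <= t - 2 * cos u by have := cos_le1 u; lra.
have b u : t - 2 * cos u <= 6 by have := cos_geN1 u; lra.
by rewrite expr2 ler_pM.
Qed.

(** The constant [ln 6] dominates the logarithm of the chord, and [2 * ln 6] that of [P] for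
    [t <= 4]; subtracting from it yields nonnegative integrands, as monotone convergence
    requires. *)
Lemma log_chord_weight_ge0 (theta phi : R) :
  0 <= (ln 6 - ln `|2 * cos theta - 2 * cos phi|) * (1 - cos phi).
Proof.
rewrite mulr_ge0 ?subr_ge0 ?cos_le1//.
(* At a vanishing chord the convention [ln 0 = 0] leaves [ln 6]. *)
have [->|d0] := eqVneq `|2 * cos theta - 2 * cos phi| 0.
  by rewrite ln0// ln_ge0// ler1n.
rewrite ler_ln ?posrE// ?lt_neqAle ?normr_ge0 1?eq_sym ?d0// ler_norml.
have := cos_geN1 theta; have := cos_le1 theta; have := cos_geN1 phi.
by have := cos_le1 phi; move=> *; apply/andP; split; lra.
Qed.

Lemma measurable_log_chord_weight (theta : R) :
  measurable_fun [set: measurableTypeR R]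
    (fun phi => (ln 6 - ln `|2 * cos theta - 2 * cos phi|) * (1 - cos phi)).
Proof.
apply: measurable_funM.
  apply: measurable_funB => //; apply: measurableT_comp => //.
  apply: measurableT_comp => //; apply: measurable_funB => //.
  apply: measurable_funM => //.
  by apply: continuous_measurable_fun; exact: continuous_cos.
by apply: continuous_measurable_fun; exact: continuous_one_sub_cos.
Qed.

(** Monotone convergence along [integral_joukowski] with [rho = 1 / r n]. The point [theta] is
    removed because there [ln 0 = 0] is not the limit of the regularized logarithms. *)
Lemma integral_arc_potential theta : 0 <= theta <= pi ->
  (\int[mu]_(phi in `[0%R, pi] `\ theta)
    (((ln 6 - ln `|2 * cos theta - 2 * cos phi|) * (1 - cos phi))%:E) =
   (pi * (ln 6 - cos theta))%:E)%E.
Proof.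
move=> theta0pi.
(* [r n] stands for [1 / rho] and decreases to [1], so that [t n = rho + 1 / rho] decreases to [2];
   moreover [r n <= 2] keeps [t n] at most [4]. *)
pose r n : R := 1 + harmonic n.
have r1 n : 1 < r n by rewrite /r ltrDl/= invr_gt0.
have r0 n : 0 < r n by rewrite (lt_trans _ (r1 n)).
have rcvg : r @ \oo --> (1 : R).
  rewrite -[X in _ --> X]addr0; apply: cvgD; first exact: cvg_cst.
  exact: cvg_harmonic.
have r_nincr n m : (n <= m)%N -> r m <= r n.
  by move=> nm; rewrite lerD2l/= lef_pV2 ?posrE// ler_nat ltnS.
pose t n := (r n)^-1 + (r n)^-1^-1.
have tE n : t n = r n + (r n)^-1 by rewrite /t invrK addrC.
have t_nincr n m : (n <= m)%N -> t m <= t n.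
  move=> nm; have := r_nincr _ _ nm; rewrite !tE.
  have := r1 m; have := r1 n; set a := r n; set b := r m => a1 b1 ab.
  have -> : a + a^-1 = b + b^-1 + (a - b) * (1 - (a * b)^-1).
    by field; rewrite !gt_eqF// ?mulr_gt0// (lt_trans _ a1, lt_trans _ b1).
  rewrite lerDl mulr_ge0 ?subr_ge0// invf_le1 ?mulr_gt0// ?(lt_trans _ a1) ?(lt_trans _ b1)//.
  by nra.
have t2 n : 2 < t n.
  rewrite tE -subr_gt0 (_ : _ - 2 = (r n - 1) ^+ 2 / r n).
    by rewrite divr_gt0// exprn_gt0// subr_gt0.
  by field; rewrite gt_eqF.
have t4 n : t n <= 4.
  have r2 : r n <= 2 by rewrite /r/= lerD2l invf_le1// ler1n.
  have rV : (r n)^-1 <= 1 by rewrite invf_le1// ltW.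
  by rewrite tE; lra.
have rVcvg : (fun n => (r n)^-1) @ \oo --> (1 : R).
  by rewrite -(invr1 R); apply: cvgV => //; exact: oner_neq0.
have tcvg : t @ \oo --> (2 : R).
  have -> : t = fun n => r n + (r n)^-1 by apply/funext => n; rewrite tE.
  by rewrite -[X in _ --> X]/(1 + 1 : R); apply: cvgD.
pose D : set (measurableTypeR R) := `[0%R, pi] `\ theta.
have mD : measurable D by apply: measurableD.
pose f n (phi : measurableTypeR R) : \bar R := ((2 * ln 6 - ln (P theta (t n) phi)) * (1 - cos phi))%:E.
have cP n : continuous (P theta (t n)).
  move=> x; apply: cvgM; apply: cvgB; try exact: cvg_cst.
    apply: cvgM; first exact: cvg_cst.
    apply: continuous_comp; last exact: continuous_cos.
    by apply: cvgD; [exact: cvg_cst|exact: cvg_id].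
  apply: cvgM; first exact: cvg_cst.
  apply: continuous_comp; last exact: continuous_cos.
  by apply: cvgB; [exact: cvg_cst|exact: cvg_id].
have clnP n : continuous (fun phi => ln (P theta (t n) phi) * (1 - cos phi)).
  move=> x; apply: cvgM; last exact: continuous_one_sub_cos.
  apply: continuous_comp; first exact: cP.
  by apply: continuous_ln; exact: P_gt0.
have cf n : continuous (fun phi => (2 * ln 6 - ln (P theta (t n) phi)) * (1 - cos phi)).
  move=> x; apply: cvgM; last exact: continuous_one_sub_cos.
  apply: cvgB; first exact: cvg_cst.
  apply: continuous_comp; first exact: cP.
  by apply: continuous_ln; exact: P_gt0.
have mf n (A : set (measurableTypeR R)) : measurable A -> measurable_fun A (f n).
  move=> mA; apply/measurable_EFinP; apply: measurable_funTS.
  exact: continuous_measurable_fun.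
have intf n : (\int[mu]_(phi in D) f n phi =
    (2 * pi * (ln 6 - (r n)^-1 * cos theta - ln (r n)))%:E)%E.
  rewrite integral_setD1//; last exact: mf.
  have rho01 : 0 < (r n)^-1 < 1.
    by apply/andP; split; [rewrite invr_gt0|rewrite invf_lt1].
  have := integral_joukowski theta rho01.
  rewrite -/(t n) lnV ?posrE// opprK => hJ.
  have iw : (\int[mu]_(x in `[0%R, pi]) ((2 * ln 6) * (1 - cos x))%:E =
      (2 * ln 6 * pi)%:E)%E.
    have dF (x : R) : is_derive x 1 (fun y => 2 * ln 6 * (y + -1 * sin y)) (2 * ln 6 * (1 - cos x)).
      have -> : 1 - cos x = 1 + -1 * cos x by rewrite mulN1r.
      by apply: is_derive_mull; apply: is_derive_addf; apply: is_derive_mull.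
    rewrite (integral_is_derive (pi_gt0 R) _ dF) ?sinpi ?sin0; first by congr EFin; ring.
    by move=> x; apply: cvgM; [exact: cvg_cst|exact: continuous_one_sub_cos].
  have -> : (\int[mu]_(phi in `[0%R, pi]) f n phi =
    \int[mu]_(x in `[0%R, pi]) ((2 * ln 6) * (1 - cos x))%:E -
    \int[mu]_(phi in `[0%R, pi]) (ln (P theta (t n) phi) * (1 - cos phi))%:E)%E.
    rewrite -integralB_EFin//=; last 2 first.
    - apply: (@continuous_integrable_itv R (fun x => 2 * ln 6 * (1 - cos x))) => x.
      by apply: cvgM; [exact: cvg_cst|exact: continuous_one_sub_cos].
    - exact: continuous_integrable_itv (clnP n).
    by apply: eq_integral => x _; rewrite -EFinB -mulrBl.
  by rewrite iw hJ -EFinB; congr EFin; ring.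
(* Away from [theta] the injectivity of [cos] on [[0, pi]] gives a positive chord, where [ln] is
   continuous. The factor [2] comes from the square of the chord. *)
have lim_f phi : D phi -> limn (f ^~ phi) =
    (2%:E * ((ln 6 - ln `|2 * cos theta - 2 * cos phi|) * (1 - cos phi))%:E)%E.
  move=> [/=]; rewrite in_itv/= => phi0pi phitheta.
  have d0 : 0 < `|2 * cos theta - 2 * cos phi|.
    rewrite normr_gt0 subr_eq0; apply/eqP => /mulfI e.
    apply: phitheta; apply/esym/cos_inj; rewrite ?in_itv//=.
    by apply: e; rewrite pnatr_eq0.
  apply/cvg_lim => //; rewrite -EFinM; apply: cvg_EFin; first exact: nearW.
  rewrite /comp/=.
  have -> : 2 * ((ln 6 - ln `|2 * cos theta - 2 * cos phi|) * (1 - cos phi)) =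
      (2 * ln 6 - ln (P theta 2 phi)) * (1 - cos phi).
    by rewrite PE subrr mul0r addr0 lnXn// mulr2n; ring.
  apply: cvgM; last exact: cvg_cst.
  apply: cvgB; first exact: cvg_cst.
  apply: continuous_cvg.
    by apply: continuous_ln; rewrite PE subrr mul0r addr0 exprn_gt0.
  by apply: cvgM; apply: cvgB => //; exact: cvg_cst.
have f0 n phi : D phi -> (0 <= f n phi)%E.
  move=> _; rewrite lee_fin mulr_ge0 ?subr_ge0 ?cos_le1//.
  have -> : 2 * ln 6 = ln (6 ^+ 2) :> R by rewrite lnXn// mulr2n; ring.
  rewrite ler_ln ?posrE ?exprn_gt0 ?P_gt0//.
  by rewrite P_le// t4 ltW.
have f_homo phi : D phi -> {homo f ^~ phi : n m / (n <= m)%N >-> (n <= m)%E}.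
  move=> _ n m nm; rewrite lee_fin ler_wpM2r ?subr_ge0 ?cos_le1// lerB//.
  by rewrite ler_ln ?posrE ?P_gt0// P_homo ?t_nincr// ltW.
have := monotone_convergence mu mD (fun n => mf n D mD) f0 f_homo.
have -> : limn (fun n => \int[mu]_(phi in D) f n phi)%E =
    (2%:E * (pi * (ln 6 - cos theta))%:E)%E.
  under eq_fun do rewrite intf.
  apply/cvg_lim => //; rewrite -EFinM; apply: cvg_EFin; first exact: nearW.
  rewrite /comp/= (_ : 2 * (pi * _) = 2 * pi * (ln 6 - 1 * cos theta - ln 1)); last first.
    by rewrite mul1r ln1; ring.
  apply: cvgM; first exact: cvg_cst.
  apply: cvgB; last by apply: continuous_cvg => //; exact: continuous_ln.
  apply: cvgB; first exact: cvg_cst.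
  by apply: cvgM; last exact: cvg_cst.
have -> : (\int[mu]_(x in D) limn (f^~ x) = \int[mu]_(x in D) (2%:E *
    ((ln 6 - ln `|2 * cos theta - 2 * cos x|) * (1 - cos x))%:E))%E.
  by apply: eq_integral => phi /set_mem Dphi; exact: lim_f.
rewrite ge0_integralZl//.
- move=> /(congr1 (fun z => 2^-1%:E * z)%E).
  by rewrite !muleA -EFinM mulVf ?pnatr_eq0// !mul1e.
- by apply/measurable_EFinP; apply: measurable_funTS; exact: measurable_log_chord_weight.
- by move=> phi _; rewrite lee_fin log_chord_weight_ge0.
Qed.

End arc_potential.

(** * Potential on the real line beyond the segment *)

Section exterior_potential.
Context {R : realType}.
Local Notation mu := (@lebesgue_measure R).

(** The difference of the two sides vanishes at [1] and has derivative [(1 - 1 / y) ^ 2]. *)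
Lemma ln_le_half_sub_inv (y : R) : 1 < y -> 2 * ln y <= y - y^-1.
Proof.
move=> y1.
pose f (x : R) := x + (-1 * x^-1 + - 2 * ln x).
pose df (x : R) : R := (1 - x^-1) ^+ 2.
have dfx (x : R) : 0 < x -> is_derive x 1 f (df x).
  move=> x0; have -> : df x = 1 + (-1 * (- x ^- 2 *: 1) + - 2 * x^-1).
    by rewrite /df [_ *: _]mulr1; field; rewrite gt_eqF.
  apply: is_derive_addf; apply: is_derive_addf.
    apply: is_derive_mull; apply: (@is_deriveV R id); first by rewrite gt_eqF.
  by apply: is_derive_mull; exact: is_derive1_ln.
have [x||] := @MVT R f df 1 y y1.
- by rewrite in_itv/= => /andP[x1 _]; apply: dfx; rewrite (lt_trans _ x1).
- apply: continuous_in_subspaceT => x /set_mem/=; rewrite in_itv/= => /andP[x1 _].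
  by apply: is_derive_continuous; apply: dfx; rewrite (lt_le_trans _ x1).
move=> c _ h.
have : 0 <= f y - f 1 by rewrite h mulr_ge0 ?exprn_even_ge0// subr_ge0 ltW.
by rewrite /f ln1 invr1; lra.
Qed.

(** With [t = rho + 1 / rho] and [theta = 0], [integral_joukowski] gives [c = rho - ln rho]; the
    preceding inequality at [1 / rho] bounds it by [t / 2]. *)
Lemma integral_exterior_potential (t : R) : 2 < t -> exists2 c : R, c <= t / 2 &
  (\int[mu]_(phi in `[0%R, pi]) (ln (t - 2 * cos phi) * (1 - cos phi))%:E =
   (pi * c)%:E)%E.
Proof.
(* [d ^ 2] is the discriminant of [x ^ 2 - t x + 1], of which [rho] is the smaller root. *)
move=> t2; pose d : R := Num.sqrt (t ^+ 2 - 4).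
have d2 : d ^+ 2 = t ^+ 2 - 4 by rewrite sqr_sqrtr//; nra.
have d0 : 0 <= d by exact: sqrtr_ge0.
have dt : d < t by nra.
pose rho := (t - d) / 2.
have rho0 : 0 < rho by rewrite /rho divr_gt0// subr_gt0.
have rhoV : rho^-1 = (t + d) / 2.
  apply: (mulfI (lt0r_neq0 rho0)); rewrite mulfV ?gt_eqF//.
  by rewrite /rho; have -> : (t - d) / 2 * ((t + d) / 2) = (t ^+ 2 - d ^+ 2) / 4;
    [field | rewrite d2; field].
have rhoV1 : 1 < rho^-1 by rewrite rhoV; lra.
have rho1 : rho < 1 by rewrite -(invf_gt1 rho0).
have tE : rho + rho^-1 = t by rewrite rhoV /rho; field.
exists (rho - ln rho).
  have := ln_le_half_sub_inv rhoV1; rewrite lnV ?posrE// invrK.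
  by rewrite -tE; lra.
have := @integral_joukowski R rho 0; rewrite rho0 rho1 tE cos0 mulr1 => /(_ isT).
have -> : (\int[mu]_(phi in `[0%R, pi]) (ln ((t - 2 * cos (0 + phi)) *
    (t - 2 * cos (0 - phi))) * (1 - cos phi))%:E =
  \int[mu]_(phi in `[0%R, pi]) (2%:E * (ln (t - 2 * cos phi) * (1 - cos phi))%:E))%E.
  apply: eq_integral => phi _; rewrite add0r sub0r cosN -EFinM; congr EFin.
  have h : 0 < t - 2 * cos phi by have := cos_le1 phi; lra.
  by rewrite lnM ?posrE//; ring.
rewrite integralZl//.
  move=> /(congr1 (fun z => 2^-1%:E * z)%E).
  rewrite !muleA -EFinM mulVf ?pnatr_eq0// !mul1e => ->.
  by rewrite -EFinM; congr EFin; field.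
apply: (@continuous_integrable_itv R (fun phi => ln (t - 2 * cos phi) * (1 - cos phi))).
move=> phi; apply: cvgM; last exact: continuous_one_sub_cos.
apply: continuous_comp; last first.
  by apply: continuous_ln; have := cos_le1 phi; lra.
apply: cvgB; first exact: cvg_cst.
by apply: cvgM; [exact: cvg_cst|exact: continuous_cos].
Qed.

End exterior_potential.

(** * Energies as integrals of squares *)

Section weighted_measure.
Local Open Scope ereal_scope.
Context d (T : measurableType d) (R : realType).
Variables (m : {measure set T -> \bar R}) (g : T -> R).
Hypotheses (mg : measurable_fun setT g) (g0 : forall x, (0 <= g x)%R).

(* The proofs are arguments so that the measure structure can be inferred. *)
Definition weighted (_ : measurable_fun setT g) (_ : forall x, (0 <= g x)%R)
  : set T -> \bar R := fun A => \int[m]_(x in A) (g x)%:E.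

Local Notation mu := (weighted mg g0).

Let weighted0 : mu set0 = 0.
Proof. exact: integral_set0. Qed.

Let weighted_ge0 A : 0 <= mu A.
Proof. by apply: integral_ge0 => x _; rewrite lee_fin. Qed.

Let weighted_sigma_additive : semi_sigma_additive mu.
Proof.
move=> /= F mF tF mUF; apply: cvg_toP.
  apply: ereal_nondecreasing_is_cvgn => p q pq.
  apply: lee_sum_nneg_natr => // k _ _; exact: weighted_ge0.
rewrite /weighted ge0_integral_bigcup//=.
  by apply: measurable_funTS; exact/measurable_EFinP.
by move=> x _; rewrite lee_fin.
Qed.

HB.instance Definition _ := isMeasure.Build _ _ _ mu
  weighted0 weighted_ge0 weighted_sigma_additive.

Import HBNNSimple.

Let integral_weighted_indic E : measurable E ->
  \int[mu]_x (\1_E x)%:E = \int[m]_x ((\1_E x)%:E * (g x)%:E).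
Proof.
move=> mE; rewrite integral_indic// setIT -[LHS]/(\int[m]_(x in E) (g x)%:E) integral_mkcond.
apply: eq_integral => x _; rewrite patchE indicE.
by case: ifPn => xE; rewrite ?mul1e ?mul0e.
Qed.

Let integral_weighted_nnsfun (f : {nnsfun T >-> R}) :
  \int[mu]_x (f x)%:E = \int[m]_x ((f x)%:E * (g x)%:E).
Proof.
under [LHS]eq_integral do rewrite fimfunE -fsumEFin//.
rewrite [LHS]ge0_integral_fsum//; last 2 first.
  - by move=> r; exact/measurable_EFinP/measurableT_comp.
  - by move=> n x _; rewrite EFinM nnfun_muleindic_ge0.
under [RHS]eq_integral.
  move=> x xD; rewrite fimfunE -fsumEFin// ge0_mule_fsuml; last first.
    by move=> r; rewrite EFinM nnfun_muleindic_ge0.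
  over.
rewrite [RHS]ge0_integral_fsum//; last 2 first.
  - move=> r; apply: emeasurable_funM; last exact/measurable_EFinP.
    by apply/measurable_EFinP/measurableT_comp.
  - move=> r x _; rewrite mule_ge0//; last by rewrite lee_fin.
    by rewrite EFinM nnfun_muleindic_ge0.
apply: eq_fsbigr => r _.
rewrite integralZl_indic_nnsfun// integral_weighted_indic//.
have [r0|r0] := leP 0%R r; last first.
  rewrite preimage_nnfun0//.
  by rewrite !integral0_eq ?mule0// => x _; rewrite indic0/= ?mulr0 mul0e.
rewrite -ge0_integralZl//.
- by apply: eq_integral => x _; rewrite EFinM muleA.
- apply: emeasurable_funM; apply/measurable_EFinP => //.
- by move=> x _; rewrite mule_ge0// lee_fin.
Qed.

(** Passes from indicators to simple functions by linearity, then to nonnegative functions by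
    monotone limits. *)
Lemma integral_weighted (f : T -> \bar R) :
  measurable_fun setT f -> (forall x, 0 <= f x) ->
  \int[mu]_x f x = \int[m]_x (f x * (g x)%:E).
Proof.
move=> mf f0.
pose f_ := nnsfun_approx measurableT mf.
transitivity (limn (fun n => \int[mu]_x (f_ n x)%:E)).
  rewrite -monotone_convergence//=.
  - apply: eq_integral => ? /[!inE] xD; apply/esym/cvg_lim => //=.
    exact: cvg_nnsfun_approx.
  - by move=> n; exact/measurable_EFinP/measurable_funTS.
  - by move=> n ? _; rewrite lee_fin.
  - by move=> ? _ ? ? mn; rewrite lee_fin; exact/lefP/nd_nnsfun_approx.
under eq_fun do rewrite integral_weighted_nnsfun.
rewrite -monotone_convergence//=.
- apply: eq_integral => x _; apply/cvg_lim => //=.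
  by apply: cvgeZr => //; exact: cvg_nnsfun_approx.
- move=> n; apply: emeasurable_funM; last exact/measurable_EFinP.
  exact/measurable_EFinP/measurable_funTS.
- by move=> n ? _; rewrite mule_ge0// lee_fin.
- move=> x _ a b ab; rewrite lee_wpmul2r// lee_fin//.
  exact/lefP/nd_nnsfun_approx.
Qed.

End weighted_measure.

(** * Sign of an integral with an integrable majorant *)

Section deficit.
Local Open Scope ereal_scope.
Context d (T : measurableType d) (R : realType).
Variables (m : {measure set T -> \bar R}) (f : T -> \bar R) (g : T -> R).
Hypotheses (mf : measurable_fun setT f) (ig : m.-integrable setT (EFin \o g)).
Hypothesis fg : forall x, f x <= (g x)%:E.

Let fE : f = fun x => (g x)%:E - ((g x)%:E - f x).
Proof.
apply/funext => x; have := fg x; case: (f x) => [r| |] //= _.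
by rewrite -!EFinB subKr.
Qed.

Let mh : measurable_fun setT (fun x => (g x)%:E - f x).
Proof. by apply: emeasurable_funB => //; exact: measurable_int ig. Qed.

Let h0 x : 0 <= (g x)%:E - f x.
Proof. by rewrite sube_ge0 ?orbT. Qed.

Lemma integral_sub_deficit : \int[m]_x ((g x)%:E - f x) < +oo ->
  \int[m]_x f x = \int[m]_x (g x)%:E - \int[m]_x ((g x)%:E - f x).
Proof.
move=> hoo; rewrite {1}fE integralB//.
apply/integrableP; split=> //.
by under eq_integral do rewrite gee0_abs//.
Qed.

(** The positive part of [f] is dominated by [|g|]; a negative part of infinite integral would make
    the integral of [f] equal to [-oo]. *)
Lemma deficit_integral_lty : 0 <= \int[m]_x f x ->
  \int[m]_x ((g x)%:E - f x) < +oo.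
Proof.
move=> f0.
have fpos : \int[m]_x f^\+ x < +oo.
  have /integrableP[mg /le_lt_trans] := ig; apply.
  apply: ge0_le_integral => //.
  - exact: measurable_funepos.
  - exact: measurableT_comp.
  - move=> x _; rewrite funeposE ge_max; apply/andP; split.
      by rewrite (le_trans (fg x))// lee_fin ler_norm.
    by rewrite lee_fin.
have fneg : \int[m]_x f^\- x < +oo.
  rewrite ltey; apply/eqP => foo; move: f0; rewrite integralE foo.
  by rewrite /= addeNy.
have hle x : (g x)%:E - f x <= `|(g x)%:E| + f^\- x.
  apply: leeD; first by rewrite lee_fin ler_norm.
  by rewrite funenegE le_max lexx.
have [_ goo] := integrableP _ _ _ ig.
apply: (@le_lt_trans _ _ (\int[m]_x (`|(g x)%:E| + f^\- x))).
  apply: ge0_le_integral => //.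
  apply: emeasurable_funD; last exact: measurable_funeneg.
  by apply: measurableT_comp => //; exact: measurable_int ig.
rewrite ge0_integralD//; first exact: lte_add_pinfty.
  by apply: measurableT_comp => //; exact: measurable_int ig.
exact: measurable_funeneg.
Qed.

(** Trades the sign of an integral that may be [-oo], such as a logarithmic energy, for a bound on
    the integral of a nonnegative function, to which Tonelli's theorem applies. *)
Lemma integral_ge0_deficit :
  (0 <= \int[m]_x f x) =
  (\int[m]_x ((g x)%:E - f x) <= \int[m]_x (g x)%:E).
Proof.
have gfin := integrable_fin_num measurableT ig.
apply/idP/idP => [f0|hg].
  have hoo := deficit_integral_lty f0.
  by move: f0; rewrite integral_sub_deficit// sube_ge0// gfin orbT.
rewrite integral_sub_deficit ?sube_ge0 ?gfin ?orbT//.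
by rewrite (le_lt_trans hg)// ltey_eq gfin.
Qed.

End deficit.

(** * Energies for a kernel given by a feature map *)

Section mutual_energy.
Local Open Scope ereal_scope.
Context d1 d2 (T : measurableType d1) (S : measurableType d2) (R : realType).
Variables (P : {sigma_finite_measure set S -> \bar R}) (Psi : T * S -> \bar R).
Hypotheses (mPsi : measurable_fun setT Psi) (Psi0 : forall z, 0 <= Psi z).

(** Tonelli's theorem twice: first for [y] and [p], then for [x] and [p]. *)
Lemma mutual_energyE (m n : {sigma_finite_measure set T -> \bar R}) :
  \int[m]_x \int[n]_y \int[P]_p (Psi (x, p) * Psi (y, p)) =
  \int[P]_p (\int[m]_x Psi (x, p) * \int[n]_y Psi (y, p)).
Proof.
have mb (k : {sigma_finite_measure set T -> \bar R}) :
    measurable_fun setT (fun p => \int[k]_y Psi (y, p)).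
  exact: measurable_fun_fubini_tonelli_G.
have mx x : measurable_fun setT (fun p => Psi (x, p)) by exact: measurableT_comp.
have my p : measurable_fun setT (fun x => Psi (x, p)) by exact: measurableT_comp.
have b0 (k : {sigma_finite_measure set T -> \bar R}) p : 0 <= \int[k]_y Psi (y, p).
  by apply: integral_ge0 => y _.
transitivity (\int[m]_x \int[P]_p (Psi (x, p) * \int[n]_y Psi (y, p))).
  apply: eq_integral => x _.
  rewrite (fubini_tonelli (fun z : T * S => Psi (x, z.2) * Psi z)).
  - by apply: eq_integral => p _ /=; rewrite ge0_integralZl.
  - by apply: emeasurable_funM => //; exact: (measurableT_comp (mx x) measurable_snd).
  - by move=> z; rewrite mule_ge0.
rewrite (fubini_tonelli (fun z : T * S => Psi z * \int[n]_y Psi (y, z.2))).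
- by apply: eq_integral => p _ /=; rewrite ge0_integralZr.
- by apply: emeasurable_funM => //; exact: (measurableT_comp (mb n) measurable_snd).
- by move=> z; rewrite mule_ge0.
Qed.

End mutual_energy.

(** * The truncated logarithmic kernel *)

Section interval_kernel.
Context {R : realType}.
Local Notation MR := (measurableTypeR R).
Local Notation leb := (@lebesgue_measure R).
Implicit Types (L x y r z d e : R).

(* The library instance making [m1 \x m2] sigma-finite is shadowed by the one
   for subprobabilities, hence this copy. *)
Definition lebesgue2 : set (MR * MR) -> \bar R := (leb \x leb)%E.

HB.instance Definition _ := Measure.on lebesgue2.

Let lebesgue2_sigma_finite : sigma_finite setT lebesgue2.
Proof.
pose I n : set MR := `[- (n%:R), n%:R]%classic.
exists (fun n => I n `*` I n) => [|n].
  apply/esym; rewrite -subTset => -[x y] _.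
  pose n := Num.bound (`|x| + `|y|).
  have hn : `|x| + `|y| < n%:R by apply: archi_boundP; rewrite addr_ge0.
  exists n => //; split; rewrite /I/= in_itv/= -ler_norml.
    by rewrite (le_trans _ (ltW hn))// lerDl.
  by rewrite (le_trans _ (ltW hn))// lerDr.
have mI : measurable (I n) by exact: measurable_itv.
split; first exact: measurableX.
rewrite [X in (X < _)%E](_ : _ = (leb (I n) * leb (I n))%E); last exact: product_measure1E.
by rewrite lebesgue_measure_itv; case: ifP; rewrite ?mul0e// -EFinB -EFinM ltry.
Qed.

HB.instance Definition _ := Measure_isSigmaFinite.Build _ _ _ lebesgue2
  lebesgue2_sigma_finite.

(* Feature map of a truncation of [- ln |x - y|]: the parameter [p = (r, z)]
   stands for the window [z, z + r]. *)
Definition window L (q : MR * (MR * MR)) : \bar R :=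
  if (0 < q.2.1 <= L) && (q.2.2 <= q.1 <= q.2.2 + q.2.1)
  then (q.2.1^-1)%:E else 0%E.

Lemma window_ge0 L q : (0 <= window L q)%E.
Proof.
by rewrite /window; case: ifP => // /andP[/andP[/ltW r0 _] _]; rewrite lee_fin invr_ge0.
Qed.

Lemma measurable_window L : measurable_fun [set: MR * (MR * MR)] (window L).
Proof.
(* On positive lengths the inverse is [expR (- ln r)], a composition of measurable functions. *)
have -> : window L = fun q => if (0 < q.2.1 <= L) && (q.2.2 <= q.1 <= q.2.2 + q.2.1)
    then (expR (- ln q.2.1))%:E else 0%E.
  apply/funext => q; rewrite /window; case: ifP => // /andP[/andP[r0 _] _].
  by rewrite expRN lnK// posrE.
have m1 : measurable_fun [set: MR * (MR * MR)] (fun q => q.1 : MR) by exact: measurable_fst.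
have m2 : measurable_fun [set: MR * (MR * MR)] (fun q => q.2.1 : MR).
  by apply: measurableT_comp => //; exact: measurable_snd.
have m3 : measurable_fun [set: MR * (MR * MR)] (fun q => q.2.2 : MR).
  by apply: measurableT_comp => //; exact: measurable_snd.
apply: measurable_fun_ifT; last exact: measurable_cst.
  apply: measurable_and; apply: measurable_and.
  - exact: measurable_fun_ltr.
  - exact: measurable_fun_ler.
  - exact: measurable_fun_ler.
  - by apply: measurable_fun_ler => //; exact: measurable_funD.
apply/measurable_EFinP; apply: measurableT_comp => //.
by apply: measurable_funN; exact: measurableT_comp.
Qed.

Definition window_kernel L x y : \bar R :=
  (\int[lebesgue2]_p (window L (x, p) * window L (y, p)))%E.

(** Contribution of the windows of length [r] to the kernel at distance [d]. *)
Let radial L (d r : R) : \bar R :=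
  (if 0 < r <= L then r ^- 2 * Num.max 0 (r - d) else 0)%:E.

Let window_kernel_radial L x y :
  window_kernel L x y = (\int[leb]_r radial L `|x - y|%R r)%E.
Proof.
have mw u : measurable_fun [set: MR * MR] (fun p => window L (u, p)).
  apply: measurableT_comp; first exact: measurable_window.
  by apply/measurable_fun_pairP; split; [exact: measurable_cst|exact: measurable_id].
rewrite /window_kernel -[LHS]/(\int[leb \x leb]_p _)%E fubini_tonelli1; last 2 first.
- by apply: emeasurable_funM.
- by move=> p; rewrite mule_ge0// window_ge0.
apply: eq_integral => r _; rewrite /fubini_F /window/= /radial.
case: ifPn => [rL|rL]; last first.
  by apply: integral0_eq => z _; rewrite mule0.
(* A window of length [r] contains both points exactly when its left end lies in [[b - r, a]]. *)
pose a := Num.min x y; pose b := Num.max x y.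
transitivity (\int[leb]_z ((r ^- 2)%:E * (\1_(`[b - r, a]%classic : set R) z)%:E))%E.
  apply: eq_integral => z _; rewrite indicE mem_setE in_itv/=.
  have -> : (b - r <= z <= a) = (z <= x <= z + r) && (z <= y <= z + r).
    rewrite /a /b lerBlDr ge_max le_min.
    by case: (z <= x); case: (z <= y); case: (x <= z + r); case: (y <= z + r).
  case: ifP => _ /=; last by rewrite mul0e mule0.
  case: ifP => _ /=; last by rewrite !mule0.
  by rewrite mule1 -EFinM -expr2 exprVn.
rewrite ge0_integralZl ?integral_indic//; last first.
- by rewrite lee_fin invr_ge0 exprn_ge0// ltW//; case/andP: rL.
- exact/measurable_EFinP/measurable_indic.
have ab : `|x - y| = b - a.
  rewrite /a /b; have [xy|xy] := leP x y.
    by rewrite distrC ger0_norm ?subr_ge0.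
  by rewrite gtr0_norm ?subr_gt0.
rewrite setIT /= lebesgue_measure_itv/= lte_fin ab.
have [h|h] := ltP (b - r) a.
  by rewrite -EFinB -EFinM; congr (_ * _)%:E; rewrite max_r; lra.
by rewrite mule0 max_l ?mulr0//; lra.
Qed.

Let radial_ge0 L d r : (0 <= radial L d r)%E.
Proof.
rewrite lee_fin; case: ifP => // _.
by rewrite mulr_ge0 ?invr_ge0 ?exprn_even_ge0// le_max lexx.
Qed.

(** A primitive is [ln r + d / r]. The choice [e = d] gives the kernel at a positive distance;
    [d = 0] with small [e] shows that it diverges on the diagonal. *)
Let integral_radial L d e : 0 <= d -> 0 < e -> d <= e -> e < L ->
  (\int[leb]_(r in `[e, L]) radial L d r = (ln L - ln e - d / e + d / L)%:E)%E.
Proof.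
move=> d0 e0 de eL.
transitivity (\int[leb]_(r in `[e, L]) (r^-1 + - d * (r^-1 * r^-1))%:E)%E.
  apply: eq_integral => r /set_mem/=; rewrite in_itv/= => /andP[er rL].
  rewrite /radial rL (lt_le_trans e0 er)/= max_r ?subr_ge0 ?(le_trans de)//.
  by congr EFin; field; rewrite gt_eqF// (lt_le_trans e0).
have cf : {in `[e, L], continuous (fun r : R => r^-1 + - d * (r^-1 * r^-1))}.
  move=> r; rewrite /= in_itv/= => /andP[er _].
  have r0 : r != 0 by rewrite gt_eqF// (lt_le_trans e0).
  apply: cvgD; first by apply: cvgV => //; exact: cvg_id.
  apply: cvgM; first exact: cvg_cst.
  by apply: cvgM; apply: cvgV => //; exact: cvg_id.
have dF (r : R) : e <= r <= L ->
    is_derive r 1 (fun r => ln r + d * r^-1) (r^-1 + - d * (r^-1 * r^-1)).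
  move=> /andP[er _]; have r0 := lt_le_trans e0 er.
  have -> : r^-1 + - d * (r^-1 * r^-1) = r^-1 + d * (- r ^- 2).
    by rewrite expr2 invfM; ring.
  apply: is_derive_addf; first exact: is_derive1_ln.
  by apply: is_derive_mull; exact: is_derive_inv.
by rewrite (integral_is_derive_itv eL cf dF); congr EFin; ring.
Qed.

Let measurable_radial L d : measurable_fun [set: MR] (radial L d).
Proof.
apply/measurable_EFinP.
rewrite (_ : (fun _ => _) = fun r => if 0 < r <= L then
    expR (- ln r) ^+ 2 * Num.max 0 (r - d) else 0).
  apply: measurable_fun_ifT => //.
    by apply: measurable_and; [exact: measurable_fun_ltr|exact: measurable_fun_ler].
  apply: measurable_funM.
    apply: measurable_funX; apply: measurableT_comp => //.
    by apply: measurable_funN; exact: measurable_ln.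
  by apply: measurable_maxr => //; exact: measurable_funB.
apply/funext => r; case: ifP => // /andP[r0 _].
by rewrite expRN lnK ?posrE// exprVn.
Qed.

Let integral_radial_sub L d (D : set MR) : measurable D ->
  (\int[leb]_(r in D) radial L d r <= \int[leb]_r radial L d r)%E.
Proof. by move=> mD; apply: ge0_subset_integral. Qed.

Let integral_radial_supp L d : 0 < d -> d < L ->
  (\int[leb]_r radial L d r = \int[leb]_(r in `[d, L]) radial L d r)%E.
Proof.
move=> d0 dL; rewrite [RHS]integral_mkcond; apply: eq_integral => r _.
rewrite patchE; case: ifPn => //; rewrite notin_setE/= in_itv/= => /negP.
rewrite negb_and -!ltNge /radial => /orP[rd|Lr].
  by rewrite max_l ?mulr0 ?if_same// subr_le0 ltW.
by rewrite (leNgt r) Lr andbF.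
Qed.

Let integral_radial0 L d : L <= d -> (\int[leb]_r radial L d r = 0)%E.
Proof.
move=> Ld; apply: integral0_eq => r _; rewrite /radial.
case: ifP => // /andP[_ rL].
by rewrite max_l ?mulr0// subr_le0 (le_trans rL).
Qed.

Let ln_div_le L d : 0 < L -> 0 < d -> ln L - ln d - 1 + d / L >= 0.
Proof.
move=> L0 d0; have dL0 : 0 < d / L by rewrite divr_gt0.
have : ln (1 + (d / L - 1)) <= d / L - 1 by apply: le_ln1Dx; lra.
by rewrite addrCA subrr addr0 ln_div ?posrE//; lra.
Qed.

(** Equality holds at positive distances [d] below [L]; from [L] on the kernel vanishes and
    [ln (d / L) <= d / L - 1] applies. On the diagonal the right side is [+oo]. *)
Lemma window_kernel_le L x y : 0 < L ->
  (window_kernel L x y <= (ln L - 1 + `|x - y| / L)%:E - lne `|x - y|%:E)%E.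
Proof.
move=> L0; rewrite window_kernel_radial; set d := `|x - y|.
have [d0|d0] := eqVneq d 0; first by rewrite d0 le0_lneNy//= addey ?leey.
have {}d0 : 0 < d by rewrite lt_neqAle eq_sym d0 normr_ge0.
rewrite lne_EFin// -EFinB.
have [dL|Ld] := ltP d L.
  rewrite integral_radial_supp// integral_radial//; last exact: ltW.
  by rewrite lee_fin divff ?gt_eqF//; lra.
rewrite integral_radial0// lee_fin.
by have := ln_div_le L0 d0; lra.
Qed.

(** Below [L] the nonnegative term [d / L] is dropped; from [L] on, [ln L <= ln d]. On the diagonal
    the kernel has to be shown infinite. *)
Lemma window_kernel_ge L x y : 0 < L ->
  ((ln L - 1)%:E - lne `|x - y|%:E <= window_kernel L x y)%E.
Proof.
move=> L0; rewrite window_kernel_radial; set d := `|x - y|.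
have [d0|d0] := eqVneq d 0; last first.
  have {}d0 : 0 < d by rewrite lt_neqAle eq_sym d0 normr_ge0.
  rewrite lne_EFin// -EFinB.
  have [dL|Ld] := ltP d L.
    rewrite integral_radial_supp// integral_radial//; last exact: ltW.
    have dL0 : 0 <= d / L by rewrite divr_ge0 ?ltW.
    by rewrite lee_fin divff ?gt_eqF//; lra.
  rewrite integral_radial0// lee_fin.
  have : ln L <= ln d by rewrite ler_ln ?posrE.
  by lra.
suff -> : (\int[leb]_r radial L d r = +oo)%E by rewrite leey.
apply: eq_infty => t.
(* Chosen so that [ln L - ln e = |t| + 1], which exceeds [t]. *)
pose e := L * expR (- (`|t| + 1)).
have e0 : 0 < e by rewrite mulr_gt0// expR_gt0.
have eL : e < L.
  by rewrite /e gtr_pMr// expR_lt1 oppr_lt0 ltr_wpDl.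
apply: le_trans (integral_radial_sub L d (measurable_itv `[e, L])).
have dge0 : 0 <= d by rewrite d0.
have de : d <= e by rewrite d0 ltW.
rewrite (integral_radial dge0 e0 de eL) d0 !mul0r lee_fin /e.
rewrite lnM ?posrE ?expR_gt0// expRK.
by have := ler_norm t; lra.
Qed.

End interval_kernel.

(** * Comparison of logarithmic energies with window energies *)

Section log_gap.
Context {R : realType}.
Local Notation MR := (measurableTypeR R).
Local Notation leb := (@lebesgue_measure R).
Local Open Scope ereal_scope.

Lemma measurable_lne d (T : measurableType d) (f : T -> R) :
  measurable_fun setT f -> measurable_fun setT (fun x => lne (f x)%:E).
Proof.
move=> mf; rewrite /lne; apply: measurable_fun_ifT => //.
  exact: measurable_fun_ler.
by apply/measurable_EFinP; exact: measurableT_comp.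
Qed.

Lemma lne_dist_le (x y : R) : (lne `|x - y|%:E <= (`|x| + `|y|)%:E)%E.
Proof.
apply: (@le_trans _ _ (`|x - y|%R%:E)); last by rewrite lee_fin ler_normB.
by apply: ltW; exact: lne_sublinear.
Qed.

(** The logarithmic kernel subtracted from a majorant that is integrable for laws with finite first
    moment. Being nonnegative, it can be integrated and compared with no condition of
    convergence. *)
Definition log_gap (z : MR * MR) : \bar R :=
  (`|z.1|%R + `|z.2|%R)%:E - lne `|z.1 - z.2|%R%:E.

Lemma log_gap_ge0 z : 0 <= log_gap z.
Proof. by rewrite sube_ge0 ?orbT// lne_dist_le. Qed.

Lemma measurable_norm_add :
  measurable_fun [set: MR * MR] (fun z => (`|z.1| + `|z.2|)%R).
Proof. by apply: measurable_funD; apply: measurableT_comp. Qed.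

Lemma measurable_lne_dist :
  measurable_fun [set: MR * MR] (fun z => lne `|z.1 - z.2|%R%:E).
Proof.
by apply: measurable_lne; apply: measurableT_comp => //; exact: measurable_funB.
Qed.

Lemma measurable_log_gap : measurable_fun [set: MR * MR] log_gap.
Proof.
apply: emeasurable_funB; last exact: measurable_lne_dist.
by apply/measurable_EFinP; exact: measurable_norm_add.
Qed.

Lemma measurable_window_kernel L :
  measurable_fun [set: MR * MR] (fun z => window_kernel L z.1 z.2).
Proof.
pose f (q : (MR * MR) * (MR * MR)) := window L (q.1.1, q.2) * window L (q.1.2, q.2).
have g1 : measurable_fun setT (fun q : (MR * MR) * (MR * MR) => (q.1.1, q.2)).
  apply/measurable_fun_pairP; split; last exact: measurable_snd.
  exact: (measurableT_comp measurable_fst measurable_fst).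
have g2 : measurable_fun setT (fun q : (MR * MR) * (MR * MR) => (q.1.2, q.2)).
  apply/measurable_fun_pairP; split; last exact: measurable_snd.
  exact: (measurableT_comp measurable_snd measurable_fst).
have mf : measurable_fun setT f.
  exact: (emeasurable_funM (measurableT_comp (@measurable_window R L) g1)
    (measurableT_comp (@measurable_window R L) g2)).
have f0 q : 0 <= f q by rewrite mule_ge0// window_ge0.
have mF := @measurable_fun_fubini_tonelli_F _ _ (MR * MR)%type (MR * MR)%type R
  lebesgue2 f mf f0.
apply: eq_measurable_fun mF => z _.
by [].
Qed.

Lemma window_kernel_ge0 (L x y : R) : 0 <= window_kernel L x y.
Proof. by apply: integral_ge0 => p _; rewrite mule_ge0// window_ge0. Qed.

Section moments.
Variables (m n : probability MR R) (a b : R).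
Hypotheses (ma : \int[m]_x `|x|%R%:E = a%:E) (nb : \int[n]_x `|x|%R%:E = b%:E).

Lemma integral_norm_add : \int[m \x n]_z (`|z.1|%R + `|z.2|%R)%:E = (a + b)%:E.
Proof.
rewrite fubini_tonelli1//; last first.
  by apply/measurable_EFinP; exact: measurable_norm_add.
transitivity (\int[m]_x (`|x|%R%:E + b%:E)).
  apply: eq_integral => x _; rewrite /fubini_F/=.
  under eq_integral do rewrite EFinD.
  rewrite ge0_integralD//= ?nb; last exact/measurable_EFinP.
  by rewrite integral_cst//= probability_setT mule1.
rewrite ge0_integralD//=; last 2 first.
- exact/measurable_EFinP.
- by move=> _ _; rewrite -nb; apply: integral_ge0 => x _; rewrite lee_fin.
by rewrite ma integral_cst//= probability_setT mule1.
Qed.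

(** The bound [window_kernel_le], integrated. Both sides are sums because the energies may be
    infinite, and [1 <= ln L] makes the constant [ln L - 1] nonnegative. *)
Lemma window_energy_le (L : R) : (1 <= ln L)%R ->
  \int[m \x n]_z window_kernel L z.1 z.2 + (a + b)%:E <=
  (ln L - 1 + (a + b) / L)%:E + \int[m \x n]_z log_gap z.
Proof.
(* As [ln] is [0] on nonpositive reals, [1 <= ln L] forces [0 < L]. *)
move=> lnL; have L0 : (0 < L)%R.
  by rewrite ltNge; apply/negP => /ln0 L0; move: lnL; rewrite L0 ler10.
pose u (z : MR * MR) : R := (ln L - 1 + (`|z.1| + `|z.2|) * L^-1)%R.
have mu' : measurable_fun setT u.
  apply: measurable_funD => //; apply: measurable_funM => //.
  exact: measurable_norm_add.
have u0 z : (0 <= u z)%R by rewrite addr_ge0 ?subr_ge0// mulr_ge0 ?addr_ge0// invr_ge0 ltW.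
have -> : (ln L - 1 + (a + b) / L)%:E = \int[m \x n]_z (u z)%:E.
  under eq_integral do rewrite /u EFinD EFinM.
  rewrite ge0_integralD//; first last.
  - by apply: emeasurable_funM => //; apply/measurable_EFinP; exact: measurable_norm_add.
  - by move=> z _; rewrite -EFinM lee_fin mulr_ge0 ?addr_ge0// invr_ge0 ltW.
  - by move=> z _; rewrite lee_fin subr_ge0.
  rewrite ge0_integralZr//; first last.
  - by rewrite lee_fin invr_ge0 ltW.
  - by apply/measurable_EFinP; exact: measurable_norm_add.
  by rewrite integral_norm_add integral_cst//= probability_setT mule1 -EFinM -EFinD.
rewrite -integral_norm_add -!ge0_integralD//; first last.
- by apply/measurable_EFinP; exact: measurable_norm_add.
- exact: measurable_window_kernel.
- by move=> z _; exact: window_kernel_ge0.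
- exact: measurable_log_gap.
- by move=> z _; exact: log_gap_ge0.
- exact/measurable_EFinP.
- by move=> z _; rewrite lee_fin.
apply: ge0_le_integral => //.
- by move=> z _; rewrite adde_ge0 ?window_kernel_ge0// lee_fin addr_ge0.
- apply: emeasurable_funD; first exact: measurable_window_kernel.
  by apply/measurable_EFinP; exact: measurable_norm_add.
- by apply: emeasurable_funD; [exact/measurable_EFinP|exact: measurable_log_gap].
move=> z _; have := window_kernel_le z.1 z.2 L0; rewrite /log_gap /u.
have dist : (`|z.1 - z.2| / L <= (`|z.1| + `|z.2|) / L)%R.
  by rewrite ler_pM2r ?invr_gt0// ler_normB.
case: (lne _) => [l| |] /=.
- rewrite -!EFinB; case: (window_kernel _ _ _) => [k| |] //=.
    by rewrite -!EFinD !lee_fin => h; lra.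
  by move=> _; rewrite addNye leNye.
- by rewrite addeNy leeNy_eq => /eqP ->; rewrite addNye leNye.
- by move=> _; rewrite !addey// leey.
Qed.

Lemma window_energy_ge (L : R) : (1 <= ln L)%R ->
  (ln L - 1)%:E + \int[m \x n]_z log_gap z <=
  \int[m \x n]_z window_kernel L z.1 z.2 + (a + b)%:E.
Proof.
move=> lnL; have L0 : (0 < L)%R.
  by rewrite ltNge; apply/negP => /ln0 L0; move: lnL; rewrite L0 ler10.
have l0 : (0 <= ln L - 1)%R by rewrite subr_ge0.
have -> : (ln L - 1)%:E = \int[m \x n]_z (ln L - 1)%:E.
  by rewrite integral_cst//= probability_setT mule1.
rewrite -integral_norm_add -!ge0_integralD//; first last.
- exact: measurable_log_gap.
- by move=> z _; exact: log_gap_ge0.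
- by apply/measurable_EFinP; exact: measurable_norm_add.
- exact: measurable_window_kernel.
- by move=> z _; exact: window_kernel_ge0.
apply: ge0_le_integral => //.
- by move=> z _; rewrite adde_ge0 ?log_gap_ge0// lee_fin.
- by apply: emeasurable_funD; [exact: measurable_cst|exact: measurable_log_gap].
- apply: emeasurable_funD; first exact: measurable_window_kernel.
  by apply/measurable_EFinP; exact: measurable_norm_add.
move=> z _; have := window_kernel_ge z.1 z.2 L0; rewrite /log_gap.
have := window_kernel_ge0 L z.1 z.2.
case: (lne _) => [l| |] /=.
- rewrite -!EFinB; case: (window_kernel _ _ _) => [k| |] //=.
    by rewrite -!EFinD !lee_fin => _ h; lra.
  by move=> _ _; rewrite addye// leey.
- by move=> k0 _; rewrite addeNy leNye.
- by rewrite addey// leye_eq => _ /eqP ->.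
Qed.

End moments.
End log_gap.

(** * Discrepancy of two probability measures *)

Section discrepancy.
Context {R : realType}.
Local Notation MR := (measurableTypeR R).
Local Open Scope ereal_scope.
Implicit Types (m n : probability MR R) (L : R) (p : MR * MR).

Definition window_mass L m p : \bar R := \int[m]_x window L (x, p).

Let window_section L p : measurable_fun [set: MR] (fun x => window L (x, p)).
Proof.
apply: measurableT_comp; first exact: measurable_window.
by apply/measurable_fun_pairP; split; [exact: measurable_id|exact: measurable_cst].
Qed.

Lemma window_massE L m r z : (0 < r <= L)%R ->
  window_mass L m (r, z) = (r^-1)%:E * m `[z, (z + r)%R]%classic.
Proof.
move=> rL; rewrite /window_mass.
have r0 : (0 <= r^-1)%R by case/andP: rL => /ltW; rewrite invr_ge0.
transitivity (\int[m]_x ((r^-1)%:E * (\1_(`[z, (z + r)%R]%classic : set MR) x)%:E)).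
  apply: eq_integral => x _; rewrite /window/= rL/= indicE mem_setE in_itv/=.
  by case: ifP => _; rewrite ?mule1 ?mule0.
rewrite ge0_integralZl ?integral_indic ?setIT//.
exact/measurable_EFinP/measurable_indic.
Qed.

Lemma window_mass_ge0 L m p : 0 <= window_mass L m p.
Proof. by apply: integral_ge0 => x _; exact: window_ge0. Qed.

Lemma window_mass_fin_num L m p : window_mass L m p \is a fin_num.
Proof.
case: p => r z; have [rL|rL] := boolP (0 < r <= L)%R.
  by rewrite window_massE// fin_numM// fin_num_measure.
by rewrite /window_mass integral0_eq// => x _; rewrite /window/= (negbTE rL).
Qed.

Lemma measurable_window_mass L m : measurable_fun [set: MR * MR] (window_mass L m).
Proof.
exact: (@measurable_fun_fubini_tonelli_G _ _ MR (MR * MR)%type R m (window L)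
  (@measurable_window R L) (@window_ge0 R L)).
Qed.

Lemma window_energyE L m n : \int[m \x n]_z window_kernel L z.1 z.2 =
  \int[lebesgue2]_p (window_mass L m p * window_mass L n p).
Proof.
rewrite fubini_tonelli1; last 2 first.
- exact: measurable_window_kernel.
- by move=> z; exact: window_kernel_ge0.
exact: (@mutual_energyE _ _ MR (MR * MR)%type R lebesgue2 (window L)
  (@measurable_window R L) (@window_ge0 R L)).
Qed.

(** The squared L2 distance of the window masses; [fine] loses nothing, by [window_mass_fin_num]. *)
Definition discrepancy L m n : \bar R := \int[lebesgue2]_p
  ((fine (window_mass L m p) - fine (window_mass L n p)) ^+ 2)%:E.

(** The identity [(u - v) ^ 2 + 2 u v = u ^ 2 + v ^ 2] under the integral. Its additive form stays
    meaningful for infinite energies. *)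
Lemma discrepancy_identity L m n :
  discrepancy L m n + 2%:E * \int[m \x n]_z window_kernel L z.1 z.2 =
  \int[m \x m]_z window_kernel L z.1 z.2 + \int[n \x n]_z window_kernel L z.1 z.2.
Proof.
rewrite !window_energyE.
have mw (k : probability MR R) : measurable_fun [set: MR * MR] (fun p => fine (window_mass L k p)).
  by apply: measurableT_comp => //; exact: measurable_window_mass.
have mww (k l : probability MR R) : measurable_fun [set: MR * MR]
    (fun p => window_mass L k p * window_mass L l p).
  by apply: emeasurable_funM; exact: measurable_window_mass.
have ww0 (k l : probability MR R) p : 0 <= window_mass L k p * window_mass L l p.
  by rewrite mule_ge0// window_mass_ge0.
rewrite -ge0_integralZl// /discrepancy -!ge0_integralD//.
- apply: eq_integral => p _.
  have := window_mass_fin_num L m p; have := window_mass_fin_num L n p.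
  move: (window_mass L m p) (window_mass L n p) => [u| |]// [v| |]// _ _.
  by rewrite /= -!EFinM -!EFinD; congr EFin; ring.
- by move=> p _; rewrite lee_fin sqr_ge0.
- by apply/measurable_EFinP; apply: measurable_funX; exact: measurable_funB.
- by move=> p _; rewrite mule_ge0.
- by apply: emeasurable_funM.
Qed.

(** In [E(m, m) - 2 E(m, n) + E(n, n)] the constants [ln L - 1] of the energy bounds cancel, so that
    the bound stays bounded as [L] grows. *)
Lemma discrepancy_le L m n (a b c : R) : (1 <= ln L)%R ->
  \int[m]_x `|x|%R%:E = a%:E -> \int[n]_x `|x|%R%:E = b%:E ->
  \int[m \x m]_z log_gap z <= (a + a)%:E ->
  \int[n \x n]_z log_gap z <= (b + b)%:E ->
  c%:E <= \int[m \x n]_z log_gap z ->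
  discrepancy L m n <= (2 * ((a + b) / L) + 2 * (a + b - c))%:E.
Proof.
move=> lnL ma nb Gm Gn Gmn.
have := window_energy_le ma ma lnL; have := window_energy_le nb nb lnL.
have := window_energy_ge ma nb lnL; have := discrepancy_identity L m n.
have D0 : 0 <= discrepancy L m n by apply: integral_ge0 => p _; rewrite lee_fin sqr_ge0.
have E0 (k l : probability MR R) : 0 <= \int[k \x l]_z window_kernel L z.1 z.2.
  by apply: integral_ge0 => z _; exact: window_kernel_ge0.
move: (E0 m m) (E0 n n) (E0 m n).
move: (discrepancy L m n) D0 (\int[m \x m]_z window_kernel L z.1 z.2)
  (\int[n \x n]_z window_kernel L z.1 z.2) (\int[m \x n]_z window_kernel L z.1 z.2)
  => D D0 Em En Emn Em0 En0 Emn0 Deq h1 h2 h3.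
have {h1} h1 : (ln L - 1 + c)%:E <= Emn + (a + b)%:E.
  by rewrite EFinD (le_trans _ h1)// leeD2l.
have {h2} h2 : En + (b + b)%:E <= (ln L - 1 + (b + b) / L + (b + b))%:E.
  by rewrite (le_trans h2)// (EFinD (ln L - 1 + _)%R) leeD2l.
have {h3} h3 : Em + (a + a)%:E <= (ln L - 1 + (a + a) / L + (a + a))%:E.
  by rewrite (le_trans h3)// (EFinD (ln L - 1 + _)%R) leeD2l.
(* The upper bounds exclude infinite [Em] and [En]; the identity then excludes infinite [Emn] and
   [D]. *)
case: Em Em0 Deq h3 => [em| |]// _; case: En En0 h2 => [en| |]// _.
case: Emn Emn0 h1 => [emn| |]// _; case: D D0 => [D| |]// _.
  rewrite -EFinM -!EFinD !lee_fin => h1 h2 [] Deq h3.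
  by lra.
  by move=> _ _; rewrite gt0_muley ?lte_fin// addey.
by move=> _ _; rewrite gt0_muley ?lte_fin// addey.
Qed.

End discrepancy.

(** * Recovery of a measure from its window masses *)

Section equality_of_measures.
Context {R : realType}.
Local Notation MR := (measurableTypeR R).
Local Open Scope ereal_scope.

(** Open right rays are stable under intersection and generate the Borel sets. *)
Lemma eq_measure_rays (m n : {measure set MR -> \bar R}) :
  (forall x : R, m `]x, +oo[%classic = n `]x, +oo[%classic) ->
  (forall x : R, m `]x, +oo[%classic < +oo) ->
  forall A : set MR, measurable A -> m A = n A.
Proof.
move=> mn moo; pose g (k : nat) : set MR := `](- (k%:R : R))%R, +oo[%classic.
move=> A mA; apply: (@measure_unique _ R MR (@RGenOInfty.G R) g) mA => //.
- exact: RGenOInfty.measurableE.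
- move=> _ _ [x ->] [y ->]; exists (Num.max x y).
  apply/seteqP; split=> z /=; rewrite !in_itv/= !andbT gt_max.
    by move=> [-> ->].
  by move=> /andP[].
- by move=> k; exists (- k%:R)%R.
- apply/seteqP; split=> // x _; exists (Num.bound `|x : R|%R) => //=.
  rewrite /g/= in_itv/= andbT ltrNl (le_lt_trans (ler_norm _))// normrN.
  exact: archi_boundP.
- by move=> _ [x ->].
- by move=> k; exact: moo.
Qed.

(** For distribution functions, [F_m(t) <= F_m(u) = F_n(u) <= F_n(t + 1 / (k + 1))] with a suitable
    [u], and [F_n] is right-continuous. *)
Lemma le_ray_frequently (m n : probability MR R) (t : R) :
  (forall e : R, (0 < e)%R -> exists2 u : R, (t < u < t + e)%R &
    m `]-oo, u]%classic = n `]-oo, u]%classic) ->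
  m `]-oo, t]%classic <= n `]-oo, t]%classic.
Proof.
move=> h; pose F (k : nat) : set MR := `]-oo, (t + k.+1%:R^-1)%R]%classic.
have tF : `]-oo, t]%classic = \bigcap_k F k.
  by rewrite (itvNycEbigcap false); apply: eq_bigcapr.
have cF : (n \o F) k @[k --> \oo] --> n `]-oo, t]%classic.
  rewrite tF; apply: nonincreasing_cvg_mu.
  - by rewrite ltey_eq fin_num_measure//; exact: measurable_itv.
  - by move=> k; exact: measurable_itv.
  - by apply: bigcapT_measurable => k; exact: measurable_itv.
  - move=> i j ij; apply/subsetPset => x; rewrite /F/= !in_itv/= => /le_trans; apply.
    by rewrite lerD2l lef_pV2 ?posrE// ler_nat.
apply: cvge_to_ge cF _; apply: nearW => k /=.
have [|u /andP[tu uk] e] := h k.+1%:R^-1%R; first by rewrite invr_gt0.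
apply: (@le_trans _ _ (m `]-oo, u]%classic)).
  apply: le_measure; rewrite ?inE; try exact: measurable_itv.
  by move=> x /=; rewrite !in_itv/= => /le_trans; apply; exact: ltW.
rewrite e; apply: le_measure; rewrite ?inE; try exact: measurable_itv.
by move=> x; rewrite /F/= !in_itv/= => /le_trans; apply; exact: ltW.
Qed.

Section rays.
Variables m n : probability MR R.
Hypotheses (m0 : m `]-oo, 0%R[%classic = 0) (n0 : n `]-oo, 0%R[%classic = 0).

(** A window starting left of [0] captures all the mass up to its right end, so its mass is a value
    of the distribution function. *)
Let ray_window (k : probability MR R) (z u : R) :
  k `]-oo, 0%R[%classic = 0 -> (z < 0)%R -> (0 <= u)%R ->
  k `]-oo, u]%classic = k `[z, u]%classic.
Proof.
move=> k0 z0 u0; apply/eqP; rewrite eq_le; apply/andP; split; last first.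
  apply: le_measure; rewrite ?inE; try exact: measurable_itv.
  by move=> x /=; rewrite !in_itv/= => /andP[].
apply: (@le_trans _ _ (k (`]-oo, 0%R[%classic `|` `[z, u]%classic))).
  apply: le_measure; rewrite ?inE.
  - exact: measurable_itv.
  - by apply: measurableU; exact: measurable_itv.
  - move=> x /=; rewrite !in_itv/= => xu; have [x0|x0] := ltP x 0%R; first by left.
    by right; rewrite xu (le_trans (ltW z0)).
apply: le_trans (measureU2 _ _ _) _; try exact: measurable_itv.
by rewrite [X in X + _](_ : _ = 0) ?add0e//; exact: k0.
Qed.

Hypothesis mn : forall L : R, (1 <= ln L)%R -> discrepancy L m n = 0.

(** A vanishing discrepancy makes the window masses agree for almost every [(r, z)]. If no [u] were
    suitable, they would differ on the whole rectangle [Q], which has positive area. *)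
Lemma ray_frequently_eq (t e : R) : (0 <= t)%R -> (0 < e)%R ->
  exists2 u : R, (t < u < t + e)%R & m `]-oo, u]%classic = n `]-oo, u]%classic.
Proof.
move=> t0 e0; apply: contrapT => hn.
pose L := (expR 1 + (t + e))%R.
have lnL : (1 <= ln L)%R.
  have e1 := expR_gt0 (1 : R).
  have L0 : (0 < L)%R by rewrite /L; lra.
  have : (ln (expR 1) <= ln L)%R by rewrite ler_ln ?posrE// /L; lra.
  by rewrite expRK.
have mw (k : probability MR R) : measurable_fun [set: MR * MR] (fun p => fine (window_mass L k p)).
  by apply: measurableT_comp => //; exact: measurable_window_mass.
have := mn lnL; rewrite /discrepancy.
under eq_integral do rewrite -[X in X%:E]ger0_norm ?sqr_ge0//.
rewrite -[LHS]/(\int[lebesgue2]_p `| ((fine (window_mass L m p) - fine (window_mass L n p)) ^+ 2)%:E |).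
move/ae_eq_integral_abs => [//||N [mN N0 NS]].
  by apply/measurable_EFinP; apply: measurable_funX; exact: measurable_funB.
(* For [(r, z)] in [Q], the left end [z] is negative and the right end [z + r] lies strictly between
   [t] and [t + e]. *)
pose Q : set (MR * MR) := `](t + e / 2)%R, (t + e)%R[%classic `*` `](- (e / 2))%R, 0%R[%classic.
have mQ : measurable Q by apply: measurableX; exact: measurable_itv.
have QN : Q `<=` N.
  move=> [r z] [/=]; rewrite !in_itv/= => /andP[r1 r2] /andP[z1 z2].
  apply: NS => /= /(_ I) [] /eqP; rewrite sqrf_eq0 subr_eq0 => /eqP.
  have rL : (0 < r <= L)%R by rewrite /L; have := expR_gt0 (1 : R); lra.
  rewrite !window_massE// !fineM ?fin_num_measure//=.
  have r0 : (r^-1 != 0)%R by rewrite invr_neq0// gt_eqF//; lra.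
  move=> /(mulfI r0) eq; apply: hn; exists (z + r)%R; first by lra.
  rewrite !(@ray_window _ z)//; [|lra|lra].
  by rewrite -[LHS]fineK ?fin_num_measure// eq fineK ?fin_num_measure.
have : 0 < lebesgue2 Q.
  rewrite [ltRHS](_ : _ = lebesgue_measure (`](t + e / 2)%R, (t + e)%R[%classic : set MR) *
    lebesgue_measure (`](- (e / 2))%R, 0%R[%classic : set MR)); last exact: product_measure1E.
  rewrite !lebesgue_measure_itv/= !lte_fin !ifT; [|lra|lra].
  by rewrite -!EFinB -EFinM lte_fin mulr_gt0//; lra.
rewrite ltNge => /negP; apply; rewrite -N0; apply: le_measure; rewrite ?inE//.
Qed.

(** Both distribution functions vanish at negative arguments; elsewhere [le_ray_frequently] applies
    in both directions. *)
Lemma discrepancy0_eq (A : set MR) : measurable A -> m A = n A.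
Proof.
have ray_eq (x : R) : m `]-oo, x]%classic = n `]-oo, x]%classic.
  have [x0|x0] := ltP x 0%R.
    have neg (k : probability MR R) : k `]-oo, 0%R[%classic = 0 ->
        k `]-oo, x]%classic = 0.
      move=> k0; apply/eqP; rewrite eq_le measure_ge0 andbT -k0.
      apply: le_measure; rewrite ?inE; try exact: measurable_itv.
      by move=> y /=; rewrite !in_itv/= => /le_lt_trans; apply.
    by rewrite !neg.
  apply/eqP; rewrite eq_le; apply/andP; split; apply: le_ray_frequently => e e0.
    exact: ray_frequently_eq.
  by have [u ue eu] := ray_frequently_eq x0 e0; exists u.
apply: eq_measure_rays => x; last by rewrite ltey_eq fin_num_measure//; exact: measurable_itv.
have raysC (k : probability MR R) : k `]x, +oo[%classic = 1 - k `]-oo, x]%classic.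
  by rewrite -setCitvl probability_setC//; exact: measurable_itv.
have := raysC m; rewrite ray_eq -raysC; exact.
Qed.

End rays.

End equality_of_measures.

(** * The extremal law *)

Section equality_on_positive_rays.
Context {R : realType}.
Local Notation MR := (measurableTypeR R).
Local Open Scope ereal_scope.

(** Allows the change of variables to be checked only away from [0], where the density is
    singular. *)
Lemma eq_measure_positive_rays (m n : {measure set MR -> \bar R}) :
  (forall y : R, (0 < y)%R -> m `[y, +oo[%classic = n `[y, +oo[%classic) ->
  m `]-oo, 0%R]%classic = 0 -> n `]-oo, 0%R]%classic = 0 ->
  (forall x : R, m `]x, +oo[%classic < +oo) ->
  forall A : set MR, measurable A -> m A = n A.
Proof.
move=> mn m0 n0 moo.
have cvg_ray (k : {measure set MR -> \bar R}) (x : R) :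
    k `[(x + i.+1%:R^-1)%R, +oo[%classic @[i --> \oo] --> k `]x, +oo[%classic.
  rewrite itvoyEbigcup; apply: nondecreasing_cvg_mu.
  - by move=> i; exact: measurable_itv.
  - by apply: bigcupT_measurable => i; exact: measurable_itv.
  - move=> i j ij; apply/subsetPset => y /=; rewrite !in_itv/= !andbT.
    by apply: le_trans; rewrite lerD2l lef_pV2 ?posrE// ler_nat.
have pos (x : R) : (0 <= x)%R -> m `]x, +oo[%classic = n `]x, +oo[%classic.
  move=> x0; have := cvg_ray m x.
  rewrite (_ : (fun i => _) = fun i => n `[(x + i.+1%:R^-1)%R, +oo[%classic).
    by move=> mx; exact: (cvg_unique _ mx (cvg_ray n x)).
  by apply/funext => i; rewrite mn// ltr_wpDl// invr_gt0.
have neg (k : {measure set MR -> \bar R}) (x : R) : (x < 0)%R ->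
    k `]-oo, 0%R]%classic = 0 -> k `]x, +oo[%classic = k `]0%R, +oo[%classic.
  move=> x0 k0; rewrite (_ : `]x, +oo[%classic =
      `]x, 0%R]%classic `|` `]0%R, +oo[%classic); last first.
    by rewrite -itv_bndbnd_setU// bnd_simp// ltW.
  rewrite measureU; try exact: measurable_itv; last first.
    apply/seteqP; split=> // y [/=]; rewrite !in_itv/= => /andP[_ /le_lt_trans h].
    by rewrite andbT => /h; rewrite ltxx.
  rewrite [X in X + _](_ : _ = 0) ?add0e//.
  apply/eqP; rewrite eq_le measure_ge0 andbT -k0; apply: le_measure;
    rewrite ?inE; try exact: measurable_itv.
  by move=> y /=; rewrite !in_itv/= => /andP[].
apply: eq_measure_rays => // x; have [x0|x0] := ltP x 0%R; last exact: pos.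
by rewrite !neg// pos.
Qed.

End equality_on_positive_rays.

(** * The law of the statement and its angular form *)

Section minimizing_law.
Context {R : realType}.
Local Notation MR := (measurableTypeR R).
Local Notation leb := (@lebesgue_measure R).
Local Notation s := (sqrt_e R).
Implicit Types x y phi : R.

Lemma sqrt_e_gt0 : 0 < s.
Proof. by rewrite sqrtr_gt0 expR_gt0. Qed.

Lemma sqr_sqrt_e : s ^+ 2 = expR 1.
Proof. by rewrite sqr_sqrtr// expR_ge0. Qed.

Lemma ln_sqrt_e : ln s = 2^-1.
Proof.
have : ln (s ^+ 2) = 1 by rewrite sqr_sqrt_e expRK.
by rewrite lnXn ?sqrt_e_gt0// mulr2n; lra.
Qed.

Definition arc_density : MR -> R := (fun phi => (1 - cos phi) / pi) \_ `[0, pi].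

Lemma measurable_arc_density : measurable_fun [set: MR] arc_density.
Proof.
apply/(measurable_restrictT _ _).1 => //; apply: measurable_funTS.
apply: measurable_funM => //; apply: continuous_measurable_fun.
exact: continuous_one_sub_cos.
Qed.

Lemma arc_density_ge0 phi : 0 <= arc_density phi.
Proof.
rewrite /arc_density patchE; case: ifP => // _.
by rewrite divr_ge0 ?pi_ge0// subr_ge0 cos_le1.
Qed.

Definition spectral_density : MR -> R := (@density_empty R) \_ `[0, 4 * s].

Lemma density_empty_ge0 x : 0 <= density_empty x.
Proof. by rewrite mulr_ge0// ?sqrtr_ge0// invr_ge0 mulr_ge0// pi_ge0. Qed.

Lemma spectral_density_ge0 x : 0 <= spectral_density x.
Proof. by rewrite /spectral_density patchE; case: ifP => // _; exact: density_empty_ge0. Qed.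

Lemma measurable_density_empty : measurable_fun (`[0, 4 * s] : set MR) (@density_empty R).
Proof.
have e0 := expR_gt0 (1 : R).
(* At [x = 0] the convention [0^-1 = 0] makes the density [0], as in the second branch. *)
apply: (@eq_measurable_fun _ _ _ _ _ (fun x => if 0 < x then
   (2 * pi)^-1 * Num.sqrt ((4 * s - x) * (expR (- 1) * expR (- ln x))) else 0)).
  move=> x /set_mem/=; rewrite in_itv/= => /andP[x0 xs].
  rewrite /density_empty; case: ifPn => [xp|]; last first.
    by rewrite -leNgt => xn; rewrite (@le_anti _ _ x 0) ?x0 ?xn// mulr0 invr0 mulr0 sqrtr0 mulr0.
  have -> : expR (- ln x) = x^-1 by rewrite expRN lnK// posrE.
  by rewrite (expRN 1) (invfM (expR 1)).
apply: measurable_funTS; apply: measurable_fun_ifT => //.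
  exact: measurable_fun_ltr.
apply: measurable_funM => //.
apply: measurableT_comp; first by apply: continuous_measurable_fun; exact: sqrt_continuous.
apply: measurable_funM; first exact: measurable_funB.
apply: measurable_funM => //; apply: measurableT_comp => //.
by apply: measurable_funN; exact: measurable_ln.
Qed.

Lemma measurable_spectral_density : measurable_fun [set: MR] spectral_density.
Proof.
apply/(measurable_restrictT _ _).1 => //; exact: measurable_density_empty.
Qed.

Definition arc_map : MR -> MR := fun phi => s * (2 + 2 * cos phi).

Lemma measurable_arc_map : measurable_fun [set: MR] arc_map.
Proof.
apply: measurable_funM => //; apply: measurable_funD => //; apply: measurable_funM => //.
by apply: continuous_measurable_fun; exact: continuous_cos.
Qed.

HB.instance Definition _ := isMeasurableFun.Build _ _ _ _ arc_map measurable_arc_map.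

(** Transparent, so that its values are convertible to integrals of [arc_density] over preimages. *)
Definition arc_law : {measure set MR -> \bar R}.
Proof.
refine (pushforward (weighted leb measurable_arc_density arc_density_ge0) arc_map).
exact: measurable_arc_map.
Defined.

Definition spectral_law : set MR -> \bar R :=
  weighted leb measurable_spectral_density spectral_density_ge0.

HB.instance Definition _ := Measure.on spectral_law.

(** The factor [s * (2 * sin phi)] is the absolute Jacobian of [arc_map], and the radicand is the
    square of [sin phi / (s * (1 + cos phi))]. *)
Lemma density_empty_arc_map phi : 0 <= phi <= pi -> -1 < cos phi ->
  density_empty (arc_map phi) * (s * (2 * sin phi)) = (1 - cos phi) / pi.
Proof.
move=> phi0pi c1; have s0 := sqrt_e_gt0; have c2 := cos_le1 phi.
have sn0 := sin_ge0_pi phi0pi.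
have cz : 1 + cos phi != 0 by rewrite gt_eqF//; lra.
have sz : s != 0 by rewrite gt_eqF.
have pz : pi != 0 :> R by rewrite gt_eqF// pi_gt0.
rewrite /density_empty /arc_map -sqr_sqrt_e.
have -> : (4 * s - s * (2 + 2 * cos phi)) / (s ^+ 2 * (s * (2 + 2 * cos phi))) =
    (sin phi / (s * (1 + cos phi))) ^+ 2.
  rewrite expr_div_n sin2cos2; field.
  by rewrite sz cz gt_eqF//; lra.
rewrite sqrtr_sqr ger0_norm; last by rewrite divr_ge0// mulr_ge0 ?ltW//; lra.
have -> : (2 * pi)^-1 * (sin phi / (s * (1 + cos phi))) * (s * (2 * sin phi)) =
   sin phi ^+ 2 / (pi * (1 + cos phi)).
  by move: (@pi R) pz => p pz; field; rewrite pz sz cz.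
by rewrite sin2cos2; move: (@pi R) pz => p pz; field; rewrite pz cz.
Qed.

Lemma is_derive_arc_map phi : is_derive phi 1 (arc_map : R -> R) (- (s * (2 * sin phi))).
Proof.
have -> : - (s * (2 * sin phi)) = s * (0 + 2 * (- sin phi)) by ring.
by apply: is_derive_mull; apply: is_derive_addf; apply: is_derive_mull.
Qed.

Lemma derive1_arc_map : (arc_map : R -> R)^`()%classic = fun phi => - (s * (2 * sin phi)).
Proof.
apply/funext => phi; rewrite derive1E; apply: derive_val.
exact: is_derive_arc_map.
Qed.

(** Substitution [x = arc_map phi], which decreases from [4 * s] at [0] to [y] at [b]. *)
Lemma arc_law_ray y : 0 < y -> arc_law `[y, +oo[%classic = spectral_law `[y, +oo[%classic.
Proof.
move=> y0; have s0 := sqrt_e_gt0.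
(* Neither law charges the points beyond [4 * s]. *)
have [ys|ys] := leP y (4 * s); last first.
  transitivity (0 : \bar R).
    apply: integral0_eq => phi /=; rewrite in_itv/= andbT /arc_map => yphi.
    exfalso; have := cos_le1 phi => c1; nra.
  apply/esym; apply: integral0_eq => x /=; rewrite in_itv/= andbT => yx.
  rewrite /spectral_density patchE ifN// notin_setE/= in_itv/= => /andP[_].
  by rewrite leNgt (lt_le_trans ys).
pose b := acos (y / (2 * s) - 1).
have yb : -1 <= y / (2 * s) - 1 <= 1.
  have : 0 < y / (2 * s) by rewrite divr_gt0 ?mulr_gt0.
  have : y / (2 * s) <= 2 by rewrite ler_pdivrMr ?mulr_gt0//; lra.
  by move=> *; lra.
have b0 : 0 <= b by exact: acos_ge0.
have bpi : b <= pi by exact: acos_lepi.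
have cosb : cos b = y / (2 * s) - 1 by rewrite /b acosK// in_itv.
have Fb : arc_map b = y by rewrite /arc_map cosb; field; rewrite gt_eqF.
have F0 : arc_map 0 = 4 * s by rewrite /arc_map cos0; ring.
have homF : {in `[0, b] &, {homo arc_map : x z /~ x < z}}.
  move=> x z; rewrite !in_itv/= => /andP[x0 xb] /andP[z0 zb] xz.
  rewrite /arc_map ltr_pM2l// ltrD2l ltr_pM2l// ltr_cos ?in_itv//=.
    by rewrite z0 (le_trans zb).
  by rewrite x0 (le_trans xb).
transitivity (\int[leb]_(phi in `[0%R, b]) ((1 - cos phi) / pi)%:E)%E.
  rewrite -[LHS]/(\int[leb]_(phi in arc_map @^-1` `[y, +oo[) (arc_density phi)%:E)%E.
  rewrite [LHS]integral_mkcond [RHS]integral_mkcond; apply: eq_integral => phi _.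
  have memF : (phi \in arc_map @^-1` `[y, +oo[%classic) = (y <= arc_map phi).
    by apply/idP/idP => [/set_mem|h]; [|apply/mem_set];
      rewrite /= in_itv/= andbT.
  rewrite !patchE memF /arc_density patchE !mem_setE !in_itv/=.
  have [phi0|] := leP 0 phi; last by case: ifP.
  have [phib|bphi] := leP phi b; rewrite /=.
    rewrite (le_trans phib)//= ifT// -Fb.
    have [->//|ne] := eqVneq phi b.
    by apply/ltW/homF; rewrite ?in_itv/= ?lexx ?b0 ?phi0 ?phib// lt_neqAle ne.
  have [phipi|//] := leP phi pi; last by case: ifP.
  rewrite ifN// -ltNge -Fb /arc_map ltr_pM2l// ltrD2l ltr_pM2l// ltr_cos//.
    by rewrite in_itv/= b0.
  by rewrite in_itv/= phi0.
transitivity (\int[leb]_(x in `[y, (4 * s)%R]) (density_empty x)%:E)%E; last first.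
  rewrite -[RHS]/(\int[leb]_(x in `[y, +oo[) (spectral_density x)%:E)%E.
  rewrite [LHS]integral_mkcond [RHS]integral_mkcond; apply: eq_integral => x _.
  rewrite !patchE /spectral_density patchE !mem_setE !in_itv/= !andbT.
  have [yx|xy]//= := leP y x.
  by rewrite (le_trans (ltW y0) yx)/=; case: ifP.
have cF' : continuous (arc_map : R -> R)^`()%classic.
  rewrite derive1_arc_map => phi; apply: cvgN; apply: cvgM; first exact: cvg_cst.
  by apply: cvgM; [exact: cvg_cst|exact: continuous_sin].
have cF : continuous (arc_map : R -> R).
  move=> phi; apply: cvgM; first exact: cvg_cst.
  apply: cvgD; first exact: cvg_cst.
  by apply: cvgM; [exact: cvg_cst|exact: continuous_cos].
have dF : derivable_oo_LRcontinuous (arc_map : R -> R) 0 b.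
  split.
  - by move=> phi _; apply: ex_derive; exact: is_derive_arc_map.
  - by apply: cvg_at_right_filter; exact: cF.
  - by apply: cvg_at_left_filter; exact: cF.
(* As [0 < y], the interval avoids the pole of the radicand at [0]. *)
have cG : {within `[arc_map b, arc_map 0], continuous (@density_empty R)}.
  apply: continuous_in_subspaceT => x /set_mem/=; rewrite in_itv/= Fb => /andP[yx _].
  have x0 : 0 < x := lt_le_trans y0 yx.
  apply: cvgM; first exact: cvg_cst.
  apply: continuous_comp; last exact: sqrt_continuous.
  apply: cvgM; first by apply: cvgB; [exact: cvg_cst|exact: cvg_id].
  apply: cvgV; first by rewrite mulf_neq0// gt_eqF// expR_gt0.
  by apply: cvgM; [exact: cvg_cst|exact: cvg_id].
have := @integration_by_substitution_decreasing R arc_map (@density_empty R) 0 b b0 homF.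
rewrite Fb F0 => -> //; last first.
- by rewrite -Fb -F0.
- by apply: cvgP; apply: cvg_at_left_filter; exact: cF'.
- by apply: cvgP; apply: cvg_at_right_filter; exact: cF'.
apply: eq_integral => phi /set_mem/=; rewrite in_itv/= => /andP[phi0 phib].
congr EFin.
transitivity (density_empty (arc_map phi) * - ((arc_map : R -> R)^`()%classic phi)) => //.
rewrite derive1_arc_map opprK density_empty_arc_map// ?phi0 ?(le_trans phib)//.
have : y <= arc_map phi.
  rewrite -Fb; have [->//|ne] := eqVneq phi b.
  by apply/ltW/homF; rewrite ?in_itv/= ?lexx ?b0 ?phi0 ?phib// lt_neqAle ne.
by rewrite /arc_map => yphi; nra.
Qed.

End minimizing_law.

(** * Total mass, and integration in the angle *)

Section spectral_law_theory.
Context {R : realType}.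
Local Notation MR := (measurableTypeR R).
Local Notation leb := (@lebesgue_measure R).
Local Notation s := (sqrt_e R).
Local Notation sigma := (@spectral_law R).
Implicit Types x y phi theta : R.

Lemma continuous_arc_map : continuous (@arc_map R : R -> R).
Proof. by move=> phi; apply: is_derive_continuous; exact: is_derive_arc_map. Qed.

(** One computation serves for the total mass, the mean and the affine parts of the potentials. *)
Lemma integral_arc_affine (a b : R) :
  (\int[leb]_(phi in `[0%R, pi]) ((a + b * arc_map phi) * ((1 - cos phi) / pi))%:E =
   (a + b * s)%:E)%E.
Proof.
(* Since [(2 + 2 cos phi) (1 - cos phi) = 2 sin ^ 2 phi], whose primitive is
   [phi - sin phi cos phi]. *)
pose F phi : R := pi^-1 * (a * (phi + -1 * sin phi) +
  (b * s) * (phi + -1 * (sin phi * cos phi))).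
have pz : pi != 0 :> R by rewrite gt_eqF// pi_gt0.
have dF (phi : R) : is_derive phi 1 F ((a + b * arc_map phi) * ((1 - cos phi) / pi)).
  have -> : (a + b * arc_map phi) * ((1 - cos phi) / pi) =
     pi^-1 * (a * (1 + -1 * cos phi) + (b * s) *
       (1 + -1 * (sin phi * (- sin phi) + cos phi * cos phi))).
    rewrite mulrN -expr2 sin2cos2 /arc_map.
    by move: (@pi R) pz => p pz; field.
  apply: is_derive_mull; apply: is_derive_addf; apply: is_derive_mull;
    apply: is_derive_addf; apply: is_derive_mull.
have cf : continuous (fun phi : R => (a + b * arc_map phi) * ((1 - cos phi) / pi)).
  move=> phi; apply: cvgM; last first.
    by apply: cvgM; [exact: continuous_one_sub_cos|exact: cvg_cst].
  apply: cvgD; first exact: cvg_cst.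
  by apply: cvgM; [exact: cvg_cst|exact: continuous_arc_map].
rewrite (integral_is_derive (pi_gt0 R) cf dF) /F sinpi sin0; congr EFin.
by move: (@pi R) pz => p pz; field.
Qed.

Lemma arc_lawT : @arc_law R setT = 1%E.
Proof.
have := integral_arc_affine 1 0; rewrite mul0r addr0 => <-.
rewrite -[LHS]/(\int[leb]_(phi in setT) (arc_density phi)%:E)%E.
rewrite [RHS]integral_mkcond; apply: eq_integral => phi _.
by rewrite /arc_density !patchE; case: ifP => // _; rewrite mul0r addr0 mul1r.
Qed.

(** On [[0, pi]] the map is nonpositive only at [pi], a negligible point. *)
Lemma arc_law_npos : @arc_law R `]-oo, 0%R]%classic = 0%E.
Proof.
rewrite -[LHS]/(\int[leb]_(phi in @arc_map R @^-1` `]-oo, 0%R]) (arc_density phi)%:E)%E.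
rewrite integral_mkcond -[RHS](integral_set1 (fun phi => (arc_density phi)%:E) pi).
rewrite [RHS]integral_mkcond; apply: eq_integral => phi _.
rewrite !patchE; have [->|phipi] := eqVneq phi (pi : R).
  rewrite ifT; last by apply/mem_set; rewrite /= in_itv/= /arc_map cospi; lra.
  by rewrite ifT//; apply/mem_set.
rewrite [RHS]ifN; last by rewrite notin_setE/=; exact/eqP.
case: ifP => // /set_mem/=; rewrite in_itv/= /arc_map => h.
rewrite /arc_density patchE; case: ifP => //; rewrite mem_setE in_itv/= => /andP[h0 h1].
have s0 := @sqrt_e_gt0 R.
have : cos pi < cos phi.
  rewrite ltr_cos ?in_itv/= ?h0 ?h1 ?pi_ge0 ?lexx//.
  by rewrite lt_neqAle phipi.
by rewrite cospi => ?; exfalso; nra.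
Qed.

Lemma spectral_law_npos : sigma `]-oo, 0%R]%classic = 0%E.
Proof.
apply: integral0_eq => x /=; rewrite in_itv/= => x0.
rewrite /spectral_density patchE; case: ifP => //; rewrite mem_setE in_itv/= => /andP[x0' _].
by rewrite (@le_anti _ _ x 0) ?x0 ?x0'// /density_empty mulr0 invr0 mulr0 sqrtr0 mulr0.
Qed.

Lemma spectral_arc_law (A : set MR) : measurable A -> sigma A = @arc_law R A.
Proof.
move=> mA; apply/esym; apply: eq_measure_positive_rays mA.
- by move=> y y0; exact: arc_law_ray.
- exact: arc_law_npos.
- exact: spectral_law_npos.
- move=> x; apply: (@le_lt_trans _ _ (@arc_law R setT)); last by rewrite arc_lawT ltry.
  by apply: le_measure; rewrite ?inE.
Qed.

Lemma spectral_lawT : sigma setT = 1%E.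
Proof. by rewrite spectral_arc_law// arc_lawT. Qed.

HB.instance Definition _ := Measure_isProbability.Build _ _ R sigma spectral_lawT.

Lemma integral_spectral_law (f : MR -> \bar R) :
  measurable_fun setT f -> (forall x, 0 <= f x)%E ->
  (\int[sigma]_x f x =
   \int[leb]_(phi in `[0%R, pi]) (f (arc_map phi) * ((1 - cos phi) / pi)%:E))%E.
Proof.
move=> mf f0.
transitivity (\int[@arc_law R]_x f x)%E.
  by apply: eq_measure_integral => A mA _; exact: spectral_arc_law.
rewrite [LHS](ge0_integral_pushforward (@measurable_arc_map R))//.
rewrite preimage_setT integral_weighted//=.
  rewrite [RHS]integral_mkcond; apply: eq_integral => phi _.
  by rewrite /arc_density !patchE; case: ifP => // _; rewrite mule0.
by apply: measurableT_comp => //; exact: measurable_arc_map.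
Qed.

End spectral_law_theory.

(** * Potential of the extremal law *)

Section spectral_potential.
Context {R : realType}.
Local Notation MR := (measurableTypeR R).
Local Notation leb := (@lebesgue_measure R).
Local Notation s := (sqrt_e R).
Local Notation sigma := (@spectral_law R).
Implicit Types x y phi theta : R.

Let arc_map_ge0 phi : 0 <= arc_map phi :> R.
Proof.
apply: mulr_ge0; first by rewrite ltW// sqrt_e_gt0.
by have := cos_geN1 phi; lra.
Qed.

Lemma integral_norm_spectral_law : (\int[sigma]_x `|x|%R%:E = s%:E)%E.
Proof.
rewrite integral_spectral_law//; last exact/measurable_EFinP.
have := @integral_arc_affine R 0 1; rewrite add0r mul1r => <-.
by apply: eq_integral => phi _; rewrite -EFinM add0r mul1r ger0_norm.
Qed.

Let gap_section x : measurable_fun [set: MR] (fun y => log_gap (x, y)).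
Proof.
apply: measurableT_comp; first exact: measurable_log_gap.
by apply/measurable_fun_pairP; split; [exact: measurable_cst|exact: measurable_id].
Qed.

(** [d] is the distance in units of [s], and [2^-1] is [ln s]. *)
Let log_gap_arc x phi (d : R) : 0 <= x -> 0 < d -> `|x - arc_map phi| = s * d ->
  log_gap (x, arc_map phi) = (x + arc_map phi - 2^-1 - ln d)%:E.
Proof.
move=> x0 d0 xd; have s0 := @sqrt_e_gt0 R.
rewrite -[LHS]/((`|x| + `|arc_map phi|)%:E - lne `|x - arc_map phi|%:E)%E.
rewrite xd lne_EFin ?mulr_gt0// lnM ?posrE// ln_sqrt_e.
by rewrite !ger0_norm// -EFinB; congr EFin; ring.
Qed.

Let continuous_affine_weight (a b : R) :
  continuous (fun phi : R => (a + b * arc_map phi) * ((1 - cos phi) / pi)).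
Proof.
move=> phi; apply: cvgM; last first.
  by apply: cvgM; [exact: continuous_one_sub_cos|exact: cvg_cst].
apply: cvgD; first exact: cvg_cst.
by apply: cvgM; [exact: cvg_cst|exact: continuous_arc_map].
Qed.

(** The value is [x + s - U x], where the potential [U x] is [x / (2 * s) - 1 / 2]. *)
Lemma integral_log_gap_inside x : 0 <= x <= 4 * s ->
  (\int[sigma]_y log_gap (x, y) = (s + 2^-1 + (1 - (2 * s)^-1) * x)%:E)%E.
Proof.
move=> /andP[x0 xs]; have s0 := @sqrt_e_gt0 R.
rewrite integral_spectral_law//; last by move=> y; exact: log_gap_ge0.
pose theta := acos (x / (2 * s) - 1).
have xb : -1 <= x / (2 * s) - 1 <= 1.
  have : 0 <= x / (2 * s) by rewrite divr_ge0// mulr_ge0// ltW.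
  have : x / (2 * s) <= 2 by rewrite ler_pdivrMr ?mulr_gt0//; lra.
  by move=> *; lra.
have costh : cos theta = x / (2 * s) - 1 by rewrite /theta acosK// in_itv.
have th0pi : 0 <= theta <= pi by rewrite acos_ge0//= acos_lepi.
have xE : x = s * (2 + 2 * cos theta) by rewrite costh; field; rewrite gt_eqF.
have pz : pi != 0 :> R by rewrite gt_eqF// pi_gt0.
pose D : set MR := `[0%R, pi] `\ theta.
have mD : measurable D by apply: measurableD => //; exact: measurable_itv.
rewrite -(@integral_setD1 _ _ theta)//; last first.
  apply: measurable_funTS; apply: emeasurable_funM.
    exact: (measurableT_comp (gap_section x) (@measurable_arc_map R)).
  apply/measurable_EFinP; apply: measurable_funM => //.
  by apply: continuous_measurable_fun; exact: continuous_one_sub_cos.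
(* The constant [ln 6] is moved from [u] to [v], so that [v] is the nonnegative integrand of
   [integral_arc_potential]. *)
pose u phi := (x - 2^-1 - ln 6 + 1 * arc_map phi) * ((1 - cos phi) / pi).
pose v phi := (ln 6 - ln `|2 * cos theta - 2 * cos phi|) * (1 - cos phi).
have cu : continuous u by exact: continuous_affine_weight.
have mv : measurable_fun [set: MR] v by exact: measurable_log_chord_weight.
transitivity (\int[leb]_(phi in D) ((u phi)%:E + (v phi)%:E * (pi^-1)%:E))%E.
  apply: eq_integral => phi /set_mem[/=]; rewrite in_itv/= => phi0pi phith.
  rewrite (@log_gap_arc _ _ `|2 * cos theta - 2 * cos phi|)//.
  - rewrite -!EFinM -EFinD; congr EFin; rewrite /u /v.
    by move: (ln 6) (ln _) (@pi R) pz => l6 ld p pz; field.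
  - rewrite normr_gt0 subr_eq0; apply/eqP => /mulfI e.
    apply: phith; apply/esym/cos_inj; rewrite ?in_itv//=.
    by apply: e; rewrite pnatr_eq0.
  - by rewrite {1}xE /arc_map -mulrBr normrM gtr0_norm//; congr (_ * `|_|); ring.
have iu : leb.-integrable D (EFin \o u).
  apply: (@integrableS _ _ _ leb `[0%R, pi]%classic) => //.
    by move=> phi [].
  exact: continuous_integrable_itv.
have ev := integral_arc_potential th0pi; rewrite -/D in ev.
have v0 phi : 0 <= v phi by exact: log_chord_weight_ge0.
have iv : leb.-integrable D (fun phi => (v phi)%:E).
  apply/integrableP; split; first by apply/measurable_EFinP; exact: measurable_funTS.
  under eq_integral do rewrite gee0_abs ?lee_fin ?v0//.
  by rewrite ev ltry.
rewrite integralD//; last exact: integrableZr.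
rewrite integralZr// ev.
rewrite [X in (X + _)%E](_ : _ = (x - 2^-1 - ln 6 + s)%:E); last first.
  rewrite integral_setD1//; last first.
    by apply/measurable_EFinP; apply: measurable_funTS; exact: continuous_measurable_fun.
  by rewrite integral_arc_affine mul1r.
rewrite costh -EFinM -EFinD; congr EFin.
by move: (ln 6) (@pi R) pz => l6 p pz; field; rewrite pz gt_eqF.
Qed.

(** The bound [c <= t / 2] says that the potential stays below the same affine function as on the
    segment. *)
Lemma integral_log_gap_outside x : 4 * s < x ->
  ((s + 2^-1 + (1 - (2 * s)^-1) * x)%:E <= \int[sigma]_y log_gap (x, y))%E.
Proof.
move=> xs; have s0 := @sqrt_e_gt0 R.
have x0 : 0 <= x by rewrite (le_trans _ (ltW xs))// mulr_ge0// ltW.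
have pz : pi != 0 :> R by rewrite gt_eqF// pi_gt0.
rewrite integral_spectral_law//; last by move=> y; exact: log_gap_ge0.
(* Chosen so that [x - arc_map phi = s * (t - 2 * cos phi)]. *)
pose t := x / s - 2.
have t2 : 2 < t by rewrite /t ltrBrDr ltr_pdivlMr//; lra.
have [c ct ec] := integral_exterior_potential t2.
pose u phi := (x - 2^-1 + 1 * arc_map phi) * ((1 - cos phi) / pi).
pose v phi := ln (t - 2 * cos phi) * (1 - cos phi).
have cu : continuous u by exact: continuous_affine_weight.
have cv : continuous v.
  move=> phi; apply: cvgM; last exact: continuous_one_sub_cos.
  apply: continuous_comp; last first.
    by apply: continuous_ln; have := cos_le1 phi; lra.
  apply: cvgB; first exact: cvg_cst.
  by apply: cvgM; [exact: cvg_cst|exact: continuous_cos].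
have -> : (\int[leb]_(phi in `[0%R, pi])
    (log_gap (x, arc_map phi) * ((1 - cos phi) / pi)%:E) =
  \int[leb]_(phi in `[0%R, pi]) ((u phi)%:E - (v phi)%:E * (pi^-1)%:E))%E.
  apply: eq_integral => phi _.
  rewrite (@log_gap_arc _ _ (t - 2 * cos phi))//.
  - rewrite -!EFinM -EFinB; congr EFin; rewrite /u /v.
    by move: (ln _) (@pi R) pz => ld p pz; field.
  - by have := cos_le1 phi; lra.
  - have e : x - arc_map phi = s * (t - 2 * cos phi).
      by rewrite /t /arc_map; field; rewrite gt_eqF.
    rewrite e ger0_norm//; apply: mulr_ge0; first exact: ltW.
    by have := cos_le1 phi; lra.
rewrite integralB//; first last.
- by apply: integrableZr => //; exact: continuous_integrable_itv.
- exact: continuous_integrable_itv.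
rewrite integralZr//; last exact: continuous_integrable_itv.
rewrite ec integral_arc_affine -EFinM -EFinB lee_fin mul1r.
have -> : pi * c * pi^-1 = c by rewrite mulrAC mulfV// mul1r.
have -> : (1 - (2 * s)^-1) * x = x - (t + 2) / 2.
  by rewrite /t; field; rewrite gt_eqF.
by lra.
Qed.

End spectral_potential.

(** * The variational inequality *)

Section variational_inequality.
Context {R : realType}.
Local Notation MR := (measurableTypeR R).
Local Notation s := (sqrt_e R).
Local Notation sigma := (@spectral_law R : probability MR R).
Implicit Types mu nu : borel_prob R.

Lemma measurable_log_gap_integral nu :
  measurable_fun [set: MR] (fun x => \int[nu]_y log_gap (x, y))%E.
Proof.
exact: (@measurable_fun_fubini_tonelli_F _ _ MR MR R nu _
  (@measurable_log_gap R) (@log_gap_ge0 R)).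
Qed.

(** The majorant [|x| + |y|] also has integral [s + s]: the energy of the law is [0]. *)
Lemma integral_log_gap_spectral_law :
  (\int[sigma \x sigma]_z log_gap z = (s + s)%:E)%E.
Proof.
have s0 := @sqrt_e_gt0 R.
rewrite fubini_tonelli1; [|exact: measurable_log_gap|exact: log_gap_ge0].
rewrite integral_spectral_law; first last.
- by move=> x; apply: integral_ge0 => y _; exact: log_gap_ge0.
- exact: measurable_log_gap_integral.
transitivity (\int[lebesgue_measure]_(phi in `[0%R, pi])
  ((s + 2^-1 + (1 - (2 * s)^-1) * arc_map phi) * ((1 - cos phi) / pi))%:E)%E.
  apply: eq_integral => phi _; rewrite [fubini_F _ _ _]integral_log_gap_inside ?EFinM//.
  rewrite /arc_map; have := cos_geN1 phi; have := cos_le1 phi => c1 c2.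
  by apply/andP; split; nra.
by rewrite integral_arc_affine; congr EFin; field; rewrite gt_eqF.
Qed.

Lemma integral_norm_mean mu : mu [set x : R | x < 0] = 0%E ->
  (\int[mu]_x `|x|%R%:E = mean mu)%E.
Proof.
move=> mu0; apply: ae_eq_integral => //; try exact/measurable_EFinP.
exists [set x : R | x < 0]; split => //.
  by rewrite -set_itvNyo; exact: measurable_itv.
move=> x /= h; rewrite ltNge; apply/negP => x0; apply: h => _.
by rewrite ger0_norm.
Qed.

(** The deficit criterion with majorant [|x| + |y|], of integral [a + a]. *)
Lemma log_energy_ge0 mu (a : R) : (\int[mu]_x `|x|%R%:E = a%:E)%E ->
  (0 <= log_energy mu)%E = (\int[mu \x mu]_z log_gap z <= (a + a)%:E)%E.
Proof.
move=> ma; rewrite -(integral_norm_add ma ma).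
apply: integral_ge0_deficit.
- exact: measurable_lne_dist.
- apply/integrableP; split; first by apply/measurable_EFinP; exact: measurable_norm_add.
  under eq_integral do rewrite gee0_abs ?lee_fin ?addr_ge0//.
  by rewrite (integral_norm_add ma ma) ltry.
- by move=> z; exact: lne_dist_le.
Qed.

(** One affine lower bound holds on the whole half-line, and its integral depends on the mean
    alone. *)
Lemma integral_log_gap_ge mu (a : R) : mu [set x : R | x < 0] = 0%E ->
  (\int[mu]_x `|x|%R%:E = a%:E)%E ->
  ((s + 2^-1 + (1 - (2 * s)^-1) * a)%:E <= \int[mu \x sigma]_z log_gap z)%E.
Proof.
move=> mu0 ma; have s0 := @sqrt_e_gt0 R.
(* This makes the slope [1 - 1 / (2 s)] nonnegative, hence also the integrand in [|x|]. *)
have s1 : 1 <= s.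
  by rewrite -[leLHS]sqrtr1 ler_sqrt ?expR_gt0// -expR0 ler_expR.
have b0 : 0 <= 1 - (2 * s)^-1 by rewrite subr_ge0 invf_le1; lra.
rewrite fubini_tonelli1; [|exact: measurable_log_gap|exact: log_gap_ge0].
have -> : ((s + 2^-1 + (1 - (2 * s)^-1) * a)%:E =
    \int[mu]_x (s + 2^-1 + (1 - (2 * s)^-1) * `|x|)%:E)%E.
  under eq_integral do rewrite EFinD EFinM.
  rewrite ge0_integralD//; first last.
  - by apply: emeasurable_funM => //; exact/measurable_EFinP.
  - by move=> x _; rewrite -EFinM lee_fin mulr_ge0.
  - by move=> x _; rewrite lee_fin; lra.
  rewrite ge0_integralZl//; last exact/measurable_EFinP.
  by rewrite ma integral_cst//= probability_setT mule1 -EFinM -EFinD.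
apply: ae_ge0_le_integral => //.
- by move=> x _; rewrite lee_fin addr_ge0 ?mulr_ge0//; lra.
- apply/measurable_EFinP; apply: measurable_funD => //.
  exact: measurable_funM.
- by move=> x _; apply: integral_ge0 => y _; exact: log_gap_ge0.
- exact: measurable_log_gap_integral.
exists [set x : R | x < 0]; split => //.
  by rewrite -set_itvNyo; exact: measurable_itv.
move=> x /= h; rewrite ltNge; apply/negP => x0; apply: h => _.
rewrite ger0_norm// /fubini_F.
have [xs|xs] := leP x (4 * s); last exact: integral_log_gap_outside.
by rewrite integral_log_gap_inside// x0.
Qed.

(** A larger [L] only admits more windows; the integrand is unchanged on the former ones. *)
Lemma discrepancy_homo mu nu (L L' : R) : L <= L' ->
  (discrepancy L mu nu <= discrepancy L' mu nu)%E.
Proof.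
move=> LL'; have mw (K : R) (k : probability MR R) :
    measurable_fun [set: MR * MR] (fun p => fine (window_mass K k p)).
  by apply: measurableT_comp => //; exact: measurable_window_mass.
apply: ge0_le_integral => //.
- by move=> p _; rewrite lee_fin sqr_ge0.
- by apply/measurable_EFinP; apply: measurable_funX; exact: measurable_funB.
- by apply/measurable_EFinP; apply: measurable_funX; exact: measurable_funB.
move=> [r z] _; rewrite lee_fin.
have [/andP[r0 rL]|rL] := boolP (0 < r <= L).
  by rewrite !window_massE ?r0 ?rL ?(le_trans rL).
have w0 (k : probability MR R) : window_mass L k (r, z) = 0%E.
  by apply: integral0_eq => x _; rewrite /window/= (negbTE rL).
by rewrite !w0 subrr expr0n/= sqr_ge0.
Qed.

Lemma discrepancy_mean_le mu (a L : R) : mu [set x : R | x < 0] = 0%E ->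
  (0 <= log_energy mu)%E -> mean mu = a%:E -> 1 <= ln L ->
  (discrepancy L mu sigma <= (2 * ((a + s) / L) + (a / s - 1))%:E)%E.
Proof.
move=> mu0 muE; rewrite -integral_norm_mean// => ma lnL.
have s0 := @sqrt_e_gt0 R.
(* The subtracted value is the lower bound of [integral_log_gap_ge], which serves as [c] in
   [discrepancy_le]. *)
have -> : a / s - 1 = 2 * (a + s - (s + 2^-1 + (1 - (2 * s)^-1) * a)).
  by field; rewrite gt_eqF.
apply: discrepancy_le => //.
- exact: integral_norm_spectral_law.
- by rewrite -(log_energy_ge0 ma).
- by rewrite integral_log_gap_spectral_law.
- exact: integral_log_gap_ge.
Qed.

End variational_inequality.

(** * Minimality and uniqueness *)

Section extremal_problem.
Context {R : realType}.
Local Notation MR := (measurableTypeR R).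
Local Notation s := (sqrt_e R).
Local Notation sigma := (@spectral_law R : probability MR R).
Implicit Types mu nu : borel_prob R.

(** If the mean were [a < s], the bound of [discrepancy_mean_le] would be negative for large [L]. *)
Lemma sqrt_e_le_mean mu : mu [set x : R | x < 0] = 0%E ->
  (0 <= log_energy mu)%E -> (s%:E <= mean mu)%E.
Proof.
move=> mu0 muE; have s0 := @sqrt_e_gt0 R.
have : (0 <= mean mu)%E.
  by rewrite -integral_norm_mean//; apply: integral_ge0 => x _; rewrite lee_fin.
case meanE : (mean mu) => [a| |]; rewrite ?leey// lee_fin => a0.
rewrite lee_fin leNgt; apply/negP => als.
have d0 : 0 < 1 - a / s by rewrite subr_gt0 ltr_pdivrMr ?mul1r.
(* The first term ensures [1 <= ln L], the second [(a + s) / L < (1 - a / s) / 4]. *)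
pose L := expR 1 + 4 * (a + s) / (1 - a / s).
have e1 := expR_gt0 (1 : R).
have t0 : 0 < 4 * (a + s) / (1 - a / s) by rewrite divr_gt0//; lra.
have L0 : 0 < L by rewrite /L; lra.
have lnL : 1 <= ln L.
  have : ln (expR 1) <= ln L by rewrite ler_ln ?posrE// /L; lra.
  by rewrite expRK.
have := discrepancy_mean_le mu0 muE meanE lnL.
rewrite leNgt => /negP; apply.
apply: (@lt_le_trans _ _ 0%E); last by apply: integral_ge0 => p _; rewrite lee_fin sqr_ge0.
rewrite lte_fin.
have : (a + s) / L < (1 - a / s) / 4.
  rewrite ltr_pdivrMr// mulrAC ltr_pdivlMr//.
  have -> : (1 - a / s) * L = (1 - a / s) * expR 1 + 4 * (a + s).
    by rewrite /L mulrDr mulrCA divff ?mulr1// gt_eqF.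
  by rewrite mulrC ltrDr mulr_gt0.
by lra.
Qed.

(** At mean [s] the bound reduces to [4 s / L']; as the discrepancy grows with its parameter, [L']
    may be taken arbitrarily large. *)
Lemma discrepancy_extremal mu (L : R) : mu [set x : R | x < 0] = 0%E ->
  (0 <= log_energy mu)%E -> mean mu = s%:E -> 1 <= ln L ->
  discrepancy L mu sigma = 0%E.
Proof.
move=> mu0 muE meanE lnL; have s0 := @sqrt_e_gt0 R.
have L0 : 0 < L.
  by rewrite ltNge; apply/negP => /ln0 L0; move: lnL; rewrite L0 ler10.
apply/eqP; rewrite eq_le; apply/andP; split; last first.
  by apply: integral_ge0 => p _; rewrite lee_fin sqr_ge0.
apply/lee_addgt0Pr => e e0; rewrite add0e.
(* Makes [4 s / L'] at most [e]. *)
pose L' := L + 4 * s / e.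
have t0 : 0 < 4 * s / e by rewrite divr_gt0// mulr_gt0.
have LL' : L <= L' by rewrite lerDl ltW.
have lnL' : 1 <= ln L' by rewrite (le_trans lnL)// ler_ln ?posrE// (lt_le_trans L0).
apply: le_trans (discrepancy_homo mu sigma LL') _.
apply: le_trans (discrepancy_mean_le mu0 muE meanE lnL') _.
rewrite lee_fin divff ?gt_eqF// subrr addr0 mulrA ler_pdivrMr ?(lt_le_trans L0)//.
have -> : e * L' = e * L + 4 * s by rewrite /L' mulrDr mulrCA divff ?mulr1// gt_eqF.
by have := mulr_gt0 e0 L0; lra.
Qed.

Lemma spectral_law_lt0 : sigma [set x : R | x < 0] = 0%E.
Proof.
apply/eqP; rewrite eq_le measure_ge0 andbT -[leRHS](@spectral_law_npos R).
apply: le_measure; rewrite ?inE; try exact: measurable_itv.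
  by rewrite -set_itvNyo; exact: measurable_itv.
by move=> x /=; rewrite in_itv/= => /ltW.
Qed.

Lemma mean_spectral_law : mean sigma = s%:E.
Proof.
by rewrite -integral_norm_mean ?integral_norm_spectral_law//; exact: spectral_law_lt0.
Qed.

Lemma log_energy_spectral_law : (0 <= log_energy sigma)%E.
Proof.
by rewrite (log_energy_ge0 (@integral_norm_spectral_law R)) integral_log_gap_spectral_law.
Qed.

End extremal_problem.

Theorem corollary1p3 (R : realType) (A : {fset {poly int}})
    (hA : forall Q, Q \in A -> nonzero_real_rooted R Q)
    (hA0 : A = fset0) :
  lambda R A = (sqrt_e R)%:E /\
  exists mu : borel_prob R,
    unique_minimizer A mu /\
    forall B : set (measurableTypeR R), measurable B ->
      mu B = (\int[lebesgue_measure]_(x in B `&` `[0%R, (4 * sqrt_e R)%R])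
                (density_empty x)%:E)%E.
Proof.
pose sigma : borel_prob R := @spectral_law R.
have fsigma : feasible A sigma.
  split; [exact: spectral_law_lt0|exact: log_energy_spectral_law|].
  by rewrite hA0 => Q; rewrite inE.
have lambdaE : lambda R A = (sqrt_e R)%:E.
  apply/eqP; rewrite eq_le; apply/andP; split.
    by apply: ereal_inf_lbound; exists sigma => //; exact: mean_spectral_law.
  apply: le_ereal_inf_tmp => _ [mu [mu0 muE _] <-].
  exact: sqrt_e_le_mean.
split=> //; exists sigma; split.
  split; first by split=> //; rewrite lambdaE; exact: mean_spectral_law.
  move=> nu [[nu0 nuE _]]; rewrite lambdaE => numean B mB.
  apply: (@discrepancy0_eq R nu sigma) => //.
  - by rewrite set_itvNyo; exact: spectral_law_lt0.
  - by move=> L lnL; exact: discrepancy_extremal.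
move=> B mB; rewrite [RHS]integral_mkcondr.
by apply: eq_integral => x _; rewrite /spectral_density restrict_EFin.
Qed.
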